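(* Let $G$ be a finite simple group, and let $G\le S_n$ be a faithful permutation representation of $G$ of minimum degree $n$. Then for all integers $k,d\ge 1$, \[ \mathcal L^{G^{k-1}}_{\mathsf{TC}}(\textsc{Word}_{G,k})\ \ge\ n^{\log_2 k},\qquad \mathcal L^{G^{k-1}}_{\mathsf{TC}_d}(\textsc{Word}_{G,k})\ \ge\ n^{d(k^{1/d}-1)}. \]
   Context: Word problem. For a permutation group $G\le S_n$, let $\overline G$ be the set of $n\times n$ permutation matrices of elements of $G$. View $\overline G^k$ as a subset of $\{0,1\}^{kn^2}$, with Boolean variables $M_{i,a,b}$ ($i\in[k]$, $a,b\in[n]$) giving entry $(a,b)$ of the $i$-th matrix. $\textsc{Word}_{G,k}:\overline G^k\to\{0,1\}$ outputs the $(1,1)$-entry of $M_1\cdots M_k$. The group $G^{k-1}$ acts faithfully on the variables by $(g_1,\dots,g_{k-1})\cdot M_{i,a,b}=M_{i,g_{i-1}(a),g_i(b)}$ with $g_0=g_k=1$; this corresponds to $(M_1,\dots,M_k)\mapsto(M_1\overline{g_1}^{-1},\overline{g_1}M_2\overline{g_2}^{-1},\dots,\overline{g_{k-1}}M_k)$. Thus $G^{k-1}\le S_{kn^2}$. Formulas. A $\mathsf{TC}$ formula over $x_1,\dots,x_m$ is a finite rooted tree with unordered children. Leaves are labeled by $0,1,x_i,\neg x_i$, and internal gates are unbounded fan-in $\textsc{maj}$ (majority) gates. Formulas are taken up to labeled-tree isomorphism. Depth is the maximum number of gates on a root-leaf path; size is the number of literal-labeled leaves. $S_m$ acts by relabeling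 indices of literals. For $P\le S_m$, $\Phi$ is $P$-invariant if $\pi\Phi=\Phi$ for all $\pi\in P$. A formula computes a partial function on $\Omega\subseteq\{0,1\}^m$ if it agrees with it on $\Omega$. $\mathcal L^P_{\mathsf{TC}_d}(f)$ (resp. $\mathcal L^P_{\mathsf{TC}}(f)$) is the minimum size of a $P$-invariant $\mathsf{TC}$ formula of depth at most $d$ (resp. unrestricted depth) computing $f$. *)

(* Defs.v *)
From Stdlib Require Import Reals List Permutation.
From mathcomp Require Import all_boot all_order all_algebra all_fingroup all_solvable.

Set Implicit Arguments.
Unset Strict Implicit.
Unset Printing Implicit Defensive.

Inductive lit (V : Type) : Type :=
| LConst of bool
| LPos of V
| LNeg of V.

(* rooted tree, internal nodes = unbounded fan-in MAJ gates; children are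
   listed, and unorderedness is taken care of by [tc_iso] below *)
Inductive tc (V : Type) : Type :=
| Leaf of lit V
| Maj of seq (tc V).

Arguments LConst {V}.
Arguments Leaf {V}.
Arguments Maj {V}.

Section Formulas.
Variable V : Type.

Definition eval_lit (x : V -> bool) (l : lit V) : bool :=
  match l with
  | LConst b => b
  | LPos v => x v
  | LNeg v => ~~ x v
  end.

Fixpoint tc_eval (x : V -> bool) (f : tc V) : bool :=
  match f with
  | Leaf l => eval_lit x l
  | Maj cs => (size cs <= 2 * count id (map (tc_eval x) cs))%N
  end.

Fixpoint tc_size (f : tc V) : nat :=
  match f with
  | Leaf (LConst _) => 0
  | Leaf _ => 1
  | Maj cs => sumn (map tc_size cs)
  end.

Fixpoint tc_depth (f : tc V) : nat :=
  match f with
  | Leaf _ => 0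
  | Maj cs => (foldr maxn 0 (map tc_depth cs)).+1
  end.

Definition relabel_lit (pi : V -> V) (l : lit V) : lit V :=
  match l with
  | LConst b => LConst b
  | LPos v => LPos (pi v)
  | LNeg v => LNeg (pi v)
  end.

Fixpoint tc_relabel (pi : V -> V) (f : tc V) : tc V :=
  match f with
  | Leaf l => Leaf (relabel_lit pi l)
  | Maj cs => Maj (map (tc_relabel pi) cs)
  end.

Inductive tc_iso : tc V -> tc V -> Prop :=
| iso_leaf l : tc_iso (Leaf l) (Leaf l)
| iso_maj cs ds es :
    Forall2 tc_iso cs ds -> Permutation ds es -> tc_iso (Maj cs) (Maj es).

Definition tc_computes (Phi : tc V) (Omega : (V -> bool) -> Prop)
  (f : (V -> bool) -> bool) : Prop :=
  forall x, Omega x -> tc_eval x Phi = f x.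

End Formulas.

(* variables M_{i,a,b}, i in [k], a,b in [n]  (0-based indices) *)
Definition wvar (k n : nat) : finType := ('I_k * 'I_n * 'I_n)%type.

Local Open Scope ring_scope.

Definition wmx (k n : nat) (x : wvar k n -> bool) (i : 'I_k) : 'M[int]_n :=
  \matrix_(a, b) ((x (i, a, b))%:R : int).

Definition word_dom (n k : nat) (G : {set {perm 'I_n}}) (x : wvar k n -> bool)
  : Prop :=
  forall i : 'I_k, exists2 g, g \in G & wmx x i = perm_mx g.
Arguments word_dom : clear implicits.

(* Word_{G,k}: the (1,1)-entry (first point = index 0) of M_1 ... M_k *)
Definition word (n k : nat) (x : wvar k n -> bool) : bool :=
  [exists a : 'I_n, (val a == 0)%N && ((\prod_(i < k) wmx x i) a a == 1)].
Arguments word : clear implicits.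

Local Close Scope ring_scope.

(* the action of (g_1,..,g_{k-1}) in G^{k-1}: with 0-based matrix index i
   (matrix number i+1) variable (i,a,b) goes to (i, g_i a, g_{i+1} b),
   where g_0 = g_k = 1 *)
Definition gcoord (n k : nat) (gs : nat -> {perm 'I_n}) (j : nat) : {perm 'I_n} :=
  if (0 < j < k)%N then gs j else 1%g.

Definition word_act (n k : nat) (gs : nat -> {perm 'I_n}) (v : wvar k n)
  : wvar k n :=
  let: (i, a, b) := v in (i, gcoord k gs i a, gcoord k gs i.+1 b).
Arguments word_act : clear implicits.

Definition word_invariant (n k : nat) (G : {set {perm 'I_n}}) (Phi : tc (wvar k n))
  : Prop :=
  forall gs : nat -> {perm 'I_n}, (forall j, gs j \in G) ->
    tc_iso (tc_relabel (word_act n k gs) Phi) Phi.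

Local Open Scope R_scope.

Definition bound_TC (n k : nat) : R := Rpower (INR n) (ln (INR k) / ln 2).

Definition bound_TCd (n k d : nat) : R :=
  Rpower (INR n) (INR d * (Rpower (INR k) (1 / INR d) - 1)).

Local Close Scope R_scope.
Arguments word_invariant : clear implicits.

(* Main.v *)
From HB Require Import structures.
Require Import Defs.
From Stdlib Require Import Reals List Permutation ClassicalEpsilon FunctionalExtensionality Lra.
From mathcomp Require Import all_boot all_order all_algebra all_fingroup all_solvable.
From mathcomp Require Import zify.

(** Write an input as a word [h] in [G^k]. The gauge group [G^(k-1)] acts on words
by [h_i |-> u_i h_i u_(i+1)^-1] and an invariant formula only sees the product of
the letters. Descending in an invariant formula, pass at every gate to a child that
separates two words which are indistinguishable at some scale [beta] under the current
symmetry group; the child's stabiliser has some index at least [n^t] in that group,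
so the child has at least [n^t] copies, and the child's own children must then
separate words that are indistinguishable at scale [beta / (t + 1)]. The scale starts
at [k] and is at most [1] at a literal, so the exponents met on the way satisfy
[prod (t_i + 1) >= k], while the size is at least [n ^ sum t_i]; concavity of the
logarithm gives both bounds.

If [G] is cyclic of order [p], two words are indistinguishable at scale [beta] when
their restrictions to any fewer than [beta] letters lie in the same orbit. The index is
a power [p^t], and at most [t] small sets of letters are needed to determine the rest.

If [G] is not abelian, Goursat's lemma replaces a stabiliser by a diagonally embedded
power of [G]. It is described by a quotient of the cycle graph whose edges are the [k]
letters, and [t] is the number of vertices lost in the quotient. The letters on which an
invariant function depends form an edge set without non-root vertices of degree one, and
two words are indistinguishable at scale [beta] when they agree on the largest edge set
that is dense at that scale. Using the density of the whole edge set, rather than bounding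
the number of broken coordinates, avoids the inequality [|G| >= n^2]. *)

Set Implicit Arguments.
Unset Strict Implicit.
Unset Printing Implicit Defensive.

(** * Isomorphism of formulas *)

Section FormulaIso.
Variable V : Type.
Implicit Types (f g h : tc V) (cs ds es : seq (tc V)).

(** Subformulas sit inside a list, where the generated principle gives no induction hypothesis; the
    inner recursion on the list supplies it. *)
Lemma tc_nested_ind (P : tc V -> Prop) :
  (forall l, P (Leaf l)) -> (forall cs, Forall P cs -> P (Maj cs)) ->
  forall f, P f.
Proof.
move=> Pl Pm; fix IH 1 => -[l|cs]; first exact: Pl.
by apply: Pm; elim: cs => [|c cs IHcs]; constructor.
Qed.

Lemma Forall2_weaken (R S : tc V -> tc V -> Prop) cs ds :
  Forall (fun c => forall d, R c d -> S c d) cs ->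
  Forall2 R cs ds -> Forall2 S cs ds.
Proof.
move=> H F; elim: F H => {cs ds} [|c d cs ds Rcd _ IH] H; constructor.
  by inversion H; subst; auto.
by inversion H; subst; apply: IH.
Qed.

Lemma Forall2_converse (R : tc V -> tc V -> Prop) cs ds :
  Forall2 R cs ds -> Forall2 (fun d c => R c d) ds cs.
Proof. by elim=> // *; constructor. Qed.

Lemma tc_iso_refl f : tc_iso f f.
Proof.
elim/tc_nested_ind: f => [l|cs H]; first exact: iso_leaf.
apply: (@iso_maj _ _ cs) => //.
by elim: H => // *; constructor.
Qed.

Lemma tc_iso_sym f g : tc_iso f g -> tc_iso g f.
Proof.
elim/tc_nested_ind: f g => [l|cs IH] g Hg.
  by inversion Hg; subst; apply: iso_leaf.
inversion Hg as [|? ds es F P]; subst.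
have F' : Forall2 (@tc_iso V) ds cs.
  by apply: (@Forall2_converse (fun c d => tc_iso d c)); apply: Forall2_weaken F.
have [cs' [P' F'']] := Permutation_Forall2 P F'.
by apply: iso_maj F'' _; apply: Permutation_sym.
Qed.

Lemma Forall2_trans (R : tc V -> tc V -> Prop) cs ds es :
  Forall (fun c => forall d e, R c d -> R d e -> R c e) cs ->
  Forall2 R cs ds -> Forall2 R ds es -> Forall2 R cs es.
Proof.
move=> H F; elim: F es H => {cs ds} [|c d cs ds Rcd _ IH] es H G.
  by inversion G; constructor.
inversion H; inversion G; subst; constructor; first by eauto.
exact: IH.
Qed.

Lemma tc_iso_trans f g h : tc_iso f g -> tc_iso g h -> tc_iso f h.
Proof.
elim/tc_nested_ind: f g h => [l|cs IH] g h Hg Hh.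
  by inversion Hg; subst.
inversion Hg as [|? ds es F P]; subst.
inversion Hh as [|? ds' es' F' P']; subst.
have [ds2 [Q G]] := Permutation_Forall2 (Permutation_sym P) F'.
apply: (@iso_maj _ _ ds2).
  exact: Forall2_trans IH F G.
exact: Permutation_trans (Permutation_sym Q) P'.
Qed.

Lemma tc_relabel_eq (p q : V -> V) f : p =1 q -> tc_relabel p f = tc_relabel q f.
Proof.
move=> pq; elim/tc_nested_ind: f => [[b|v|v]|cs H] //=; rewrite ?pq //.
by congr Maj; elim: H => //= c l -> _ ->.
Qed.

Lemma tc_relabel_comp (p q : V -> V) f :
  tc_relabel p (tc_relabel q f) = tc_relabel (p \o q) f.
Proof.
elim/tc_nested_ind: f => [[b|v|v]|cs H] //=.
by congr Maj; elim: H => //= c l -> _ ->.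
Qed.

Lemma tc_relabel_id f : tc_relabel id f = f.
Proof.
elim/tc_nested_ind: f => [[b|v|v]|cs H] //=.
by congr Maj; elim: H => //= c l -> _ ->.
Qed.

Lemma tc_iso_relabel p f g : tc_iso f g -> tc_iso (tc_relabel p f) (tc_relabel p g).
Proof.
elim/tc_nested_ind: f g => [l|cs IH] g Hg.
  by inversion Hg; subst; apply: tc_iso_refl.
inversion Hg as [|? ds es F P]; subst => /=.
apply: (@iso_maj _ _ (map (tc_relabel p) ds)).
  elim: F IH => {P Hg} [|c d l l' cd _ IHl] H /=; constructor.
    by inversion H; subst; auto.
  by apply: IHl; inversion H.
exact: (Permutation_map (tc_relabel p) P).
Qed.

Lemma tc_eval_relabel x p f : tc_eval x (tc_relabel p f) = tc_eval (x \o p) f.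
Proof.
elim/tc_nested_ind: f => [[b|v|v]|cs H] //=.
rewrite size_map -map_comp; congr (_ <= 2 * _); congr count.
by elim: H => //= c l -> _ ->.
Qed.

Lemma tc_eval_ext (x y : V -> bool) f : x =1 y -> tc_eval x f = tc_eval y f.
Proof.
move=> xy; elim/tc_nested_ind: f => [[b|v|v]|cs H] //=; rewrite ?xy //.
by congr (_ <= 2 * _); congr count; elim: H => //= c l -> _ ->.
Qed.

Lemma sumn_iso (T : tc V -> nat) cs ds es :
  Forall (fun c => forall d, tc_iso c d -> T c = T d) cs ->
  Forall2 (@tc_iso V) cs ds -> Permutation ds es ->
  sumn (map T cs) = sumn (map T es).
Proof.
move=> H F P; have ->: sumn (map T cs) = sumn (map T ds).
  elim: F H {P} => //= c d l l' cd _ IH H.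
  by inversion H as [|? ? Hc Hl]; subst; rewrite IH // (Hc d).
by elim: P => //= *; lia.
Qed.

Lemma tc_size_iso f g : tc_iso f g -> tc_size f = tc_size g.
Proof.
elim/tc_nested_ind: f g => [l|cs IH] g Hg; inversion Hg as [|? ds es F P]; subst => //=.
exact: sumn_iso IH F P.
Qed.

Lemma size_iso cs ds es :
  Forall2 (@tc_iso V) cs ds -> Permutation ds es -> size cs = size es.
Proof.
move=> F P; have ->: size cs = size ds by elim: F => //= c d l l' _ _ ->.
by elim: P => //= *; lia.
Qed.

Lemma tc_eval_iso x f g : tc_iso f g -> tc_eval x f = tc_eval x g.
Proof.
elim/tc_nested_ind: f g => [l|cs IH] g Hg; inversion Hg as [|? ds es F P]; subst => //=.
rewrite (size_iso F P) -!sumn_count -!map_comp.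
congr (_ <= 2 * _); apply: sumn_iso F P.
by elim: IH => // c l E _ ?; constructor => // d /E /= ->.
Qed.

Definition count_true (x : V -> bool) cs := sumn (map (fun c => tc_eval x c : nat) cs).

Lemma tc_eval_maj x cs : tc_eval x (Maj cs) = (size cs <= 2 * count_true x cs).
Proof. by rewrite /= -sumn_count -map_comp. Qed.

Lemma count_true_iso x cs es :
  tc_iso (Maj cs) (Maj es) -> count_true x cs = count_true x es.
Proof.
move=> H; inversion H as [|? ds ? F P]; subst.
apply: sumn_iso F P; elim: cs {H} => // c cs IH; constructor => // d.
by move/(tc_eval_iso x) ->.
Qed.

(** With no literal, every leaf is constant and the value cannot depend on the input. *)
Lemma tc_size_gt0 x y f : tc_eval x f <> tc_eval y f -> 0 < tc_size f.
Proof.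
rewrite lt0n => Hxy; apply/negP => /eqP f0; apply: Hxy.
elim/tc_nested_ind: f f0 => [[b|v|v]|cs H] // /= s0.
congr (_ <= 2 * _); congr count.
elim: H s0 => //= c l E _ IH s0.
by rewrite E ?IH //; lia.
Qed.

Lemma In_nth (f0 : tc V) (c : tc V) cs :
  List.In c cs -> exists2 j, j < size cs & nth f0 cs j = c.
Proof.
elim: cs => //= a cs IH [->|/IH [j lt_j <-]]; first by exists 0.
by exists j.+1.
Qed.

Lemma iso_child cs es c :
  tc_iso (Maj cs) (Maj es) -> List.In c cs -> exists2 e, List.In e es & tc_iso c e.
Proof.
move=> H Hc; inversion H as [|? ds ? F P]; subst.
have [d [dds cd]] : exists d, List.In d ds /\ tc_iso c d.
  elim: F Hc {P H} => //= a b l l' ab _ IH [<-|/IH [d [? ?]]].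
    by exists b; split; [left|].
  by exists d; split; [right|].
by exists d => //; apply: Permutation_in P dds.
Qed.

Lemma depth_child cs c : List.In c cs -> tc_depth c < tc_depth (Maj cs).
Proof.
elim: cs => //= a cs IH [->|/IH /=]; first by rewrite ltnS leq_maxl.
by rewrite !ltnS => /leq_trans -> //; rewrite leq_maxr.
Qed.

End FormulaIso.

(** * Descent through an invariant formula *)

Section Descent.
Variables (V X : Type) (aT : finGroupType).
Variables (w : aT -> V -> V) (inp : X -> V -> bool) (act : aT -> X -> X).
Hypothesis w1 : w 1%g =1 id.
Hypothesis wM : forall u v, w (u * v)%g =1 w v \o w u.
Hypothesis inp_act : forall u x, inp (act u x) =1 inp x \o w u.

Definition ev (f : tc V) (x : X) := tc_eval (inp x) f.

(** Isomorphism is a proposition while membership in a finite set is boolean, hence the classical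
    decision. *)
Definition tc_stab (f : tc V) : {set aT} :=
  [set u | if excluded_middle_informative (tc_iso (tc_relabel (w u) f) f)
           then true else false].

Lemma tc_stabP f u : reflect (tc_iso (tc_relabel (w u) f) f) (u \in tc_stab f).
Proof.
by rewrite inE; case: excluded_middle_informative => H; constructor.
Qed.

Lemma relabelM u v f :
  tc_relabel (w (u * v)%g) f = tc_relabel (w v) (tc_relabel (w u) f).
Proof. by rewrite tc_relabel_comp; apply: tc_relabel_eq; apply: wM. Qed.

Lemma tc_stab_group_set f : group_set (tc_stab f).
Proof.
apply/group_setP; split.
  apply/tc_stabP; rewrite (tc_relabel_eq _ w1) tc_relabel_id.
  exact: tc_iso_refl.
move=> u v /tc_stabP Hu /tc_stabP Hv; apply/tc_stabP.
rewrite relabelM; apply: tc_iso_trans Hv.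
exact: tc_iso_relabel.
Qed.
Canonical tc_stab_group f := group (tc_stab_group_set f).

Lemma ev_relabel u f x : ev (tc_relabel (w u) f) x = ev f (act u x).
Proof.
by rewrite /ev tc_eval_relabel; apply: tc_eval_ext => v; rewrite inp_act.
Qed.

Lemma ev_stab u f x : u \in tc_stab f -> ev f (act u x) = ev f x.
Proof. by move/tc_stabP/(tc_eval_iso (inp x)) => E; rewrite -ev_relabel. Qed.

Lemma count_true_stab u cs x : u \in tc_stab (Maj cs) ->
  count_true (inp (act u x)) cs = count_true (inp x) cs.
Proof.
move/tc_stabP => /= /(count_true_iso (inp x)) <-.
rewrite /count_true -map_comp; congr sumn; apply: eq_map => c /=.
by rewrite -/(ev _ _) -ev_relabel.
Qed.

(** The number of true children is invariant under [U], so [#|U|] times it equals the total over the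
    children of their sums over [U]. If these sums agreed child by child, the gate would not
    separate [x] from [y]. *)
Lemma separating_child (U : {group aT}) cs x y :
  U \subset tc_stab (Maj cs) -> ev (Maj cs) x <> ev (Maj cs) y ->
  exists2 c, List.In c cs &
    \sum_(u in U) (ev c (act u x) : nat) <> \sum_(u in U) (ev c (act u y) : nat).
Proof.
move=> sU; rewrite /ev !tc_eval_maj => Hxy.
apply: NNPP => Hno; apply: Hxy.
have E z : #|U| * count_true (inp z) cs =
           sumn (map (fun c => \sum_(u in U) (ev c (act u z) : nat)) cs).
  transitivity (\sum_(u in U) count_true (inp (act u z)) cs).
    rewrite -sum_nat_const; apply: eq_bigr => u uU.
    by rewrite count_true_stab // (subsetP sU).
  rewrite /count_true; elim: (cs) => [|c l IH] /=; first by rewrite big1.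
  by rewrite big_split IH.
have: #|U| * count_true (inp x) cs = #|U| * count_true (inp y) cs.
  rewrite !E; congr sumn.
  have: forall c, List.In c cs -> \sum_(u in U) (ev c (act u x) : nat) =
                                  \sum_(u in U) (ev c (act u y) : nat).
    by move=> c Hc; apply: NNPP => Hne; apply: Hno; exists c.
  elim: (cs) => //= c l IH H; rewrite H ?IH //; last by left.
  by move=> d Hd; apply: H; right.
by move/eqP; rewrite eqn_pmul2l ?cardG_gt0 // => /eqP ->.
Qed.

(** Orbit counting: each element of [U] carries [c] to the child at some position [j], and the
    elements [T j] doing so for a fixed [j] lie in one coset of the stabiliser of [c]. *)
Lemma size_orbit (U : {group aT}) cs c :
  U \subset tc_stab (Maj cs) -> List.In c cs ->
  #|U : U :&: tc_stab c|%g * tc_size c <= tc_size (Maj cs).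
Proof.
move=> sU Hc; set S := (U :&: tc_stab c)%G.
pose cj (j : 'I_(size cs)) := nth c cs j.
pose T j := [set u in U | if excluded_middle_informative
               (tc_iso (tc_relabel (w u) c) (cj j)) then true else false].
have TP j u : reflect (u \in U /\ tc_iso (tc_relabel (w u) c) (cj j)) (u \in T j).
  rewrite inE; case: (u \in U) => /=; last by constructor; case.
  by case: excluded_middle_informative => H /=; constructor; [|case].
have cardT j : #|T j| * tc_size c <= #|S| * tc_size (cj j).
  have [->|[u0 u0T]] := set_0Vmem (T j); first by rewrite cards0.
  have /TP [u0U iso0] := u0T.
  have Rsz u : tc_size (tc_relabel (w u) c) = tc_size c.
    elim/tc_nested_ind: (c) => [[b|v|v]|l H] //=; rewrite -map_comp.
    by elim: H => //= ? ? -> _ ->.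
  rewrite -(tc_size_iso iso0) Rsz leq_mul2r; apply/orP; right.
  rewrite -(card_rcoset S u0); apply: subset_leq_card; apply/subsetP => u.
  case/TP => uU iso; rewrite mem_rcoset inE groupM ?groupV //=.
  apply/tc_stabP; rewrite relabelM.
  have: tc_iso (tc_relabel (w u) c) (tc_relabel (w u0) c).
    exact: tc_iso_trans iso (tc_iso_sym iso0).
  move/(tc_iso_relabel (w u0^-1%g)); rewrite -[X in tc_iso _ X]relabelM mulgV.
  by rewrite (tc_relabel_eq _ w1) tc_relabel_id.
have cover : #|U| <= \sum_j #|T j|.
  rewrite -sum1_card (eq_bigr (fun j => \sum_(u in T j) 1)); last first.
    by move=> j _; rewrite sum1_card.
  rewrite (exchange_big_dep (mem U)) /=; last by move=> j u _ /TP [].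
  apply: leq_sum => u uU; rewrite sum1_card; apply/card_gt0P.
  have /tc_stabP /= iso : u \in tc_stab (Maj cs) by apply: (subsetP sU).
  have Hrc : List.In (tc_relabel (w u) c) (map (tc_relabel (w u)) cs).
    exact: (List.in_map (tc_relabel (w u))).
  have [e He ce] := iso_child iso Hrc.
  have [j lt_j Ej] := In_nth c He.
  by exists (Ordinal lt_j); apply/TP; rewrite /cj /= Ej.
have sizeE : tc_size (Maj cs) = \sum_j tc_size (cj j).
  by rewrite /= sumnE big_map (big_nth c) big_mkord.
rewrite -(leq_pmul2l (cardG_gt0 S)) mulnA.
rewrite -/S Lagrange ?subsetIl // sizeE big_distrr /=.
apply: (@leq_trans (\sum_j #|T j| * tc_size c)); last first.
  by apply: leq_sum => j _; apply: cardT.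
by rewrite -big_distrl leq_mul2r cover orbT.
Qed.

(* [R s q] is the indistinguishability relation at the scale [k / q]: it starts
   at scale [k], and one level of the formula divides the scale by [t.+1] while
   multiplying the size by at least [n ^ t]. *)
Variables (n k : nat) (state : Type) (grp : state -> {group aT}).
Variable R : state -> nat -> X -> X -> Prop.

Hypothesis step : forall s (U : {group aT}), U \subset grp s ->
  exists t s', [/\ n ^ t <= #|grp s : U|%g, grp s' \subset U &
    forall q (f : X -> bool) x y, q * t.+1 < k -> R s q x y ->
      \sum_(u in grp s) (f (act u x) : nat) <> \sum_(u in grp s) (f (act u y) : nat) ->
      exists x' y', R s' (q * t.+1) x' y' /\ f x' <> f y'].

Hypothesis leaf : forall s q x y l, q < k -> R s q x y ->
  (forall u z, u \in grp s ->
     eval_lit (inp (act u z)) l = eval_lit (inp z) l) ->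
  eval_lit (inp x) l = eval_lit (inp y) l.

Lemma formula_descent (f : tc V) s q x y :
  grp s \subset tc_stab f -> R s q x y -> ev f x <> ev f y ->
  exists ts : seq nat, [/\ size ts <= tc_depth f,
    k <= q * \prod_(t <- ts) t.+1 & n ^ sumn ts <= tc_size f].
Proof.
elim/tc_nested_ind: f s q x y => [l|cs IH] s q x y sU Rxy fxy;
  have f_gt0 := tc_size_gt0 fxy; have [le_kq|lt_qk] := leqP k q;
  try by exists [::]; split => //; rewrite big_nil muln1.
- case: fxy; apply: leaf lt_qk Rxy _ => u z uU.
  by have := ev_stab z (subsetP sU _ uU).
have [c Hc cxy] := separating_child sU fxy.
have [t [s' [le_nt sU' Hst]]] := step (subsetIl (grp s) (tc_stab c)).
have Hsz := size_orbit sU Hc.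
(* [step] yields a new pair only while the scale stays above [1]; otherwise the descent stops with
   the single exponent [t]. The child [c] still has a literal, since a constant child would have
   equal sums at [x] and [y]. *)
have [le_kq|lt_qk'] := leqP k (q * t.+1).
  exists [:: t]; split=> //=; first by rewrite big_seq1.
  rewrite addn0; apply: leq_trans le_nt _; apply: leq_trans Hsz.
  rewrite leq_pmulr // lt0n; apply/negP => /eqP c0; apply: cxy.
  apply: eq_bigr => u _; congr nat_of_bool; apply: NNPP => /tc_size_gt0.
  by rewrite c0.
have [x' [y' [Rxy' cxy']]] := Hst _ _ _ _ lt_qk' Rxy cxy.
have sU2 : grp s' \subset tc_stab c by apply: subset_trans sU' (subsetIr _ _).
have {}IH := (proj1 (List.Forall_forall _ _) IH) c Hc s' _ _ _ sU2 Rxy' cxy'.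
case: IH => ts [dts kts nts]; exists (t :: ts); split.
- exact: leq_ltn_trans dts (depth_child Hc).
- by rewrite big_cons mulnA.
- rewrite /= expnD; apply: leq_trans Hsz; exact: leq_mul.
Qed.

End Descent.

(** * Powers of a group and Goursat's lemma *)

Definition gpow (I : finType) (gT : finGroupType) : Type := {ffun I -> gT}.

Section PowerGroup.
Variables (I : finType) (gT : finGroupType).
Local Notation T := (gpow I gT).

HB.instance Definition _ := Finite.on T.

Definition gpow_mul (x y : T) : T := [ffun i => (x i * y i)%g].
Definition gpow_inv (x : T) : T := [ffun i => (x i)^-1%g].
Definition gpow_one : T := [ffun=> 1%g].

Lemma gpow_mulA : associative gpow_mul.
Proof. by move=> x y z; apply/ffunP => i; rewrite !ffunE mulgA. Qed.
Lemma gpow_mul1 : left_id gpow_one gpow_mul.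
Proof. by move=> x; apply/ffunP => i; rewrite !ffunE mul1g. Qed.
Lemma gpow_mulV : left_inverse gpow_one gpow_inv gpow_mul.
Proof. by move=> x; apply/ffunP => i; rewrite !ffunE mulVg. Qed.

HB.instance Definition _ := Finite_isGroup.Build T gpow_mulA gpow_mul1 gpow_mulV.

Lemma gpowM (x y : T) i : (x * y)%g i = (x i * y i)%g.
Proof. by rewrite ffunE. Qed.
Lemma gpowV (x : T) i : x^-1%g i = (x i)^-1%g.
Proof. by rewrite ffunE. Qed.
Lemma gpow1 i : (1%g : T) i = 1%g.
Proof. by rewrite ffunE. Qed.
Lemma gpow_ext (x y : T) : (forall i, x i = y i) -> x = y.
Proof. by move=> H; apply/ffunP. Qed.

Definition sgl (i : I) (x : gT) : T := [ffun j => if j == i then x else 1%g].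

Lemma sglE i x j : sgl i x j = if j == i then x else 1%g.
Proof. by rewrite ffunE. Qed.

Lemma sglM i : {morph sgl i : x y / (x * y)%g}.
Proof.
by move=> x y; apply: gpow_ext => j; rewrite gpowM !sglE; case: eqP; rewrite ?mulg1.
Qed.
End PowerGroup.

Section Theta.
Variables (gT : finGroupType) (I J : finType).
Variables (cl : I -> option J) (al : I -> gT -> gT).

(** The diagonal embedding: coordinate [i] carries a twisted copy of its class, and is trivial when
    it has none. *)
Definition theta (g : gpow J gT) : gpow I gT :=
  [ffun i => oapp (fun v => al i (g v)) 1%g (cl i)].

Lemma thetaE g i : theta g i = oapp (fun v => al i (g v)) 1%g (cl i).
Proof. by rewrite ffunE. Qed.

Lemma thetaM : (forall i, {morph al i : x y / (x * y)%g}) ->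
  {morph theta : x y / (x * y)%g}.
Proof.
move=> alM x y; apply: gpow_ext => i; rewrite gpowM !thetaE.
by case: (cl i) => [v|] /=; rewrite ?mulg1 // gpowM alM.
Qed.
End Theta.

Section Goursat.
Variables (gT : finGroupType) (n : nat).
Hypothesis simple_gT : simple [set: gT].
Hypothesis nab_gT : ~~ abelian [set: gT].
Hypothesis index_gT : forall H : {group gT}, H :!=: [set: gT] -> n * #|H| <= #|gT|.

Lemma normal_trivial (H : {group gT}) :
  (forall x y, x \in H -> (x ^ y)%g \in H) -> H :=: 1%g \/ H :=: [set: gT].
Proof.
move=> HJ; have [_ max] := simpleP _ simple_gT; apply: max.
apply/normalP; split=> [|y _]; first exact: subsetT.
apply/eqP; rewrite eqEcard cardJg leqnn andbT; apply/subsetP => z.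
by case/imsetP => x xH ->; apply: HJ.
Qed.

Lemma gT_neq1 : [set: gT] != 1%g.
Proof. by have [] := simpleP _ simple_gT. Qed.

Lemma center_gT z : (forall x : gT, commute z x) -> z = 1%g.
Proof.
move=> cz; have zZ : z \in 'Z([set: gT])%g.
  by apply/centerP; split=> // x _; apply: cz.
have [x y xZ|/= Z1|/= ZT] := @normal_trivial 'Z([set: gT])%G.
- have /centerP [_ cx] := xZ; by rewrite /conjg (cx y (in_setT y)) mulKg.
- by move: zZ; rewrite Z1 => /set1P.
- case/negP: nab_gT; rewrite -ZT; exact: center_abelian.
Qed.

Lemma endo_inj (b : gT -> gT) : {morph b : x y / (x * y)%g} ->
  (exists x, b x != 1%g) -> injective b.
Proof.
move=> bM [x0 bx0]; pose bm := Morphism (D := [set: gT]) (in2W bM).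
have bJ x y : b (x ^ y)%g = (b x ^ b y)%g.
  exact: (morphJ bm (in_setT x) (in_setT y)).
have bV x : b x^-1%g = (b x)^-1%g by exact: (morphV bm (in_setT x)).
have [x y|/= K1|/= KT] := @normal_trivial ('ker bm)%G.
- by rewrite !inE /= => /eqP bx; rewrite bJ bx conj1g.
- move=> x y bxy; apply/eqP; rewrite eq_mulgV1; apply/eqP/set1P.
  by rewrite -[[set 1%g]]K1 !inE /= bM bV bxy mulgV.
- case/eqP: bx0; have: x0 \in ('ker bm)%g by rewrite KT inE.
  by rewrite !inE /= => /eqP.
Qed.

(** A factor with nontrivial image maps onto the group, since its restriction is injective. The
    other factors commute with it, so their images are central, hence trivial. *)
Lemma morph_gpow (J : finType) (phi : gpow J gT -> gT) :
  {morph phi : x y / (x * y)%g} ->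
  (forall g, phi g = 1%g) \/
  exists v b, [/\ {morph b : x y / (x * y)%g}, injective b & forall g, phi g = b (g v)].
Proof.
move=> phiM.
have phi1 : phi 1%g = 1%g by apply: (mulgI (phi 1%g)); rewrite -phiM !mulg1.
have [/existsP [v /existsP [x0 nx0]]|none] :=
  boolP [exists v, exists x, phi (sgl v x) != 1%g].
  right; pose b x := phi (sgl v x).
  have bM : {morph b : x y / (x * y)%g} by move=> x y; rewrite /b sglM phiM.
  have b_inj : injective b by apply: endo_inj => //; exists x0.
  exists v, b; split=> // g; rewrite -[g in LHS](mulgKV (sgl v (g v)) g) phiM.
  set r := (g * _)%g; rewrite (@center_gT (phi r)) ?mul1g // => x.
  have [y ->] : exists y, x = b y.
    by have [c _ cK] := injF_bij b_inj; exists (c x); rewrite cK.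
  rewrite /commute /b -!phiM; congr phi; apply: gpow_ext => j.
  by rewrite !gpowM gpowV !sglE; case: eqP => [->|_]; rewrite ?mulgV ?mulg1 ?mul1g.
left=> g; pose res (S : {set J}) : gpow J gT := [ffun j => if j \in S then g j else 1%g].
have resE S : phi (res S) = 1%g.
  elim: {S}_.+1 {-2}S (ltnSn #|S|) => // m IH S ltS.
  have [->|[v vS]] := set_0Vmem S.
    by rewrite -phi1; congr phi; apply: gpow_ext => j; rewrite !ffunE inE.
  have -> : res S = (sgl v (g v) * res (S :\ v))%g.
    apply: gpow_ext => j; rewrite gpowM sglE !ffunE !inE.
    by case: (eqVneq j v) => [->|]; rewrite ?vS ?mulg1 ?mul1g.
  rewrite phiM IH ?mulg1; last by move: ltS; rewrite (cardsD1 v) vS.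
  by move: none; rewrite negb_exists => /forallP/(_ v); rewrite negb_exists
    => /forallP/(_ (g v)); rewrite negbK => /eqP.
rewrite -(resE setT); congr phi; apply: gpow_ext => j.
by rewrite ffunE inE.
Qed.

Lemma n_le_gT : n <= #|gT|.
Proof.
have := @index_gT 1%G; rewrite cards1 muln1; apply.
by rewrite eq_sym gT_neq1.
Qed.

(** Induction on the support, splitting off a coordinate [i]. If [L] projects to a proper subgroup
    at [i], the index gains a factor [n] and the coordinate is made trivial. If the projection is
    full, either [L] contains the whole factor, which becomes a new class, or [L] is a graph over
    the other coordinates. The last conclusion says that each lost class costs a factor [n] in the
    index. *)
Lemma goursat (I : finType) (S : {set I}) (L : {group gpow I gT}) :
  (forall l i, l \in L -> i \notin S -> l i = 1%g) ->
  exists (J : finType) (cl : I -> option J) (al : I -> gT -> gT),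
  [/\ forall i, i \notin S -> cl i = None,
      forall v, exists i, cl i = Some v,
      forall i, {morph al i : x y / (x * y)%g} /\ injective (al i),
      forall g, theta cl al g \in L &
      n ^ #|S| * #|L| <= n ^ #|J| * #|gT| ^ #|S|].
Proof.
elim: {S}_.+1 {-2}S (ltnSn #|S|) L => // m IH S ltS L suppL.
have [S0|[i iS]] := set_0Vmem S.
  exists void, (fun=> None), (fun=> id); split=> //.
  - by move=> j; split=> // x y.
  - move=> g; have -> : theta (fun _ : I => None) (fun=> id) g = 1%g.
      by apply: gpow_ext => j; rewrite !ffunE.
    exact: group1.
  - rewrite card_void S0 cards0 !expn0 !mul1n.
    apply: leq_trans (_ : #|[set (1%g : gpow I gT)]| <= 1); last by rewrite cards1.
    apply: subset_leq_card; apply/subsetP => l lL; apply/set1P; apply: gpow_ext => j.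
    by rewrite gpow1; apply: suppL => //; rewrite S0 inE.
pose S' := S :\ i.
have ltS' : #|S'| < m by move: ltS; rewrite (cardsD1 i) iS.
have cardS : #|S| = #|S'|.+1 by rewrite (cardsD1 i) iS.
have suppS' l : l i = 1%g -> (forall j, j \notin S -> l j = 1%g) ->
    forall j, j \notin S' -> l j = 1%g :> gT.
  by move=> li lS j; rewrite !inE negb_and negbK => /orP[/eqP ->|/lS].
have eM : {in [set: gpow I gT] &, {morph (fun l : gpow I gT => l i) : x y / (x * y)%g}}.
  by move=> x y _ _; rewrite gpowM.
pose em := Morphism eM.
pose p (l : gpow I gT) : gpow I gT := [ffun j => if j == i then 1%g else l j].
have pM : {in [set: gpow I gT] &, {morph p : x y / (x * y)%g}}.
  by move=> x y _ _; apply: gpow_ext => j; rewrite !(gpowM, ffunE); case: eqP; rewrite ?mulg1.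
pose pm := Morphism pM.
have pV x : p x^-1%g = (p x)^-1%g by exact: (morphV pm (in_setT x)).
have pM2 : {morph p : x y / (x * y)%g} by move=> x y; apply: (pM x y); rewrite inE.
pose K := ('ker_L em)%G; pose Q := (em @* L)%G.
have KP l : reflect (l \in L /\ l i = 1%g) (l \in K).
  by rewrite !inE /=; apply: (iffP andP) => -[lL /eqP].
have QP x : reflect (exists2 l, l \in L & x = l i) (x \in Q).
  apply: (iffP idP) => [/morphimP [l _ lL ->]|[l lL ->]]; first by exists l.
  by rewrite (mem_morphim em) ?inE.
have cardL : #|L| = #|K| * #|Q|.
  by rewrite /= card_morphim setTI -indexgI Lagrange // subsetIl.
have suppK l j : l \in K -> j \notin S' -> l j = 1%g.
  by case/KP => lL li jS'; apply: suppS' => // ? ?; apply: suppL.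
have [QT|QnT] := eqVneq (Q : {set gT}) [set: gT]; last first.
  have [J [cl [al [clN clS alP thL cardJ]]]] := IH _ ltS' K suppK.
  exists J, cl, al; split=> //.
  - by move=> j jS; apply: clN; apply: contra jS; rewrite inE => /andP[].
  - by move=> g; have /KP [] := thL g.
  have := leq_mul cardJ (index_gT QnT); rewrite cardL cardS !expnS.
  by rewrite mulnACA [n ^ _ * n]mulnC -[X in _ <= X -> _]mulnA [#|gT| ^ _ * _]mulnC.
have [/forallP free|/forallPn [x0 nx0]] := boolP [forall x, sgl i x \in L].
  have [J [cl [al [clN clS alP thL cardJ]]]] := IH _ ltS' K suppK.
  exists (option J), (fun j => if j == i then Some None else omap Some (cl j)),
    (fun j => if j == i then id else al j); split.
  - move=> j jS; case: eqP => [ji|_]; first by rewrite ji iS in jS.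
    by rewrite clN // !inE negb_and jS orbT.
  - case=> [v|]; last by exists i; rewrite eqxx.
    have [j cj] := clS v; exists j; case: eqP => [ji|_]; last by rewrite cj.
    by move: cj; rewrite clN // ji !inE eqxx.
  - by move=> j; case: eqP => _; [split|apply: alP].
  - move=> g; pose g' : gpow J gT := [ffun v => g (Some v)].
    suff -> : theta (fun j => if j == i then Some None else omap Some (cl j))
       (fun j => if j == i then id else al j) g = (theta cl al g' * sgl i (g None))%g.
      by rewrite groupM //; have /KP [] := thL g'.
    apply: gpow_ext => j; rewrite gpowM !thetaE sglE; case: eqP => [->|_] /=.
      by rewrite clN ?mul1g // !inE eqxx.
    by case: (cl j) => [v|] /=; rewrite mulg1 // ffunE.
  - rewrite card_option cardL QT cardsT cardS !expnS.
    have := leq_mul (leqnn (n * #|gT|)) cardJ.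
    by rewrite mulnACA [X in _ <= X -> _]mulnACA [#|gT| * #|K|]mulnC.
(* The elements of [L] supported at [i] form a proper subgroup normalised by [Q],
   hence are trivial, and [L] is the graph of a morphism over its projection. *)
have p_inj : {in L &, injective p}.
  have trivN l : l \in L -> p l = 1%g -> l = 1%g.
    move=> lL pl; pose N := [set x | sgl i x \in L].
    have sgl1 : sgl i (1%g : gT) = 1%g.
      by apply: gpow_ext => j; rewrite sglE gpow1 if_same.
    have Ngrp : group_set N.
      apply/group_setP; split=> [|x y]; first by rewrite inE sgl1 group1.
      by rewrite !inE sglM => *; rewrite groupM.
    have Esgl : l = sgl i (l i).
      apply: gpow_ext => j; rewrite sglE; case: eqP => [->//|/eqP ji].
      by have /= := congr1 (fun x : gpow I gT => x j) pl; rewrite ffunE gpow1 (negPf ji).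
    have [x y|/= N1|/= NT] := @normal_trivial (group Ngrp).
    - rewrite !inE => xL.
      have /QP [l' l'L ->] : y \in Q by rewrite QT inE.
      suff -> : sgl i (x ^ l' i)%g = (sgl i x ^ l')%g by rewrite groupJ.
      apply: gpow_ext => j; rewrite /conjg !gpowM gpowV !sglE.
      by case: eqP => [->//|_]; rewrite mul1g mulVg.
    - rewrite Esgl (_ : l i = 1%g) //; apply/set1P; rewrite -[[set 1%g]]N1 inE.
      by rewrite -Esgl.
    - by case/negP: nx0; have : x0 \in N by [rewrite NT inE]; rewrite inE.
  move=> x y xL yL pxy; apply/eqP; rewrite eq_mulgV1; apply/eqP; apply: trivN.
    by rewrite groupM ?groupV.
  by rewrite pM2 pV pxy mulgV.
pose Lb := (pm @* L)%G.
have cardLb : #|Lb| = #|L|.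
  by rewrite /= morphimEsub ?subsetT // card_in_imset.
have suppLb l j : l \in Lb -> j \notin S' -> l j = 1%g.
  case/morphimP => l' _ l'L -> jS' /=; apply: suppS' => // [|j' j'S].
    by rewrite ffunE eqxx.
  by rewrite ffunE; case: eqP => // _; apply: suppL.
have [J [cl [al [clN clS alP thL cardJ]]]] := IH _ ltS' Lb suppLb.
(* No class is created for [i] here, and [n <= #|gT|] pays for this loss. *)
have {}cardJ : n ^ #|S| * #|L| <= n ^ #|J| * #|gT| ^ #|S|.
  have := leq_mul cardJ n_le_gT; rewrite cardLb cardS !expnS.
  by rewrite mulnC mulnA -[X in _ <= X -> _]mulnA [#|gT| ^ _ * _]mulnC.
have cliN : cl i = None by apply: clN; rewrite !inE eqxx.
have lift_ex g : exists l, (l \in L) && (p l == theta cl al g).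
  by have /morphimP [l _ lL El] := thL g; exists l; rewrite lL El /=.
pose lft g := xchoose (lift_ex g).
have lftL g : lft g \in L by case/andP: (xchooseP (lift_ex g)).
have lftE g : p (lft g) = theta cl al g by case/andP: (xchooseP (lift_ex g)) => _ /eqP.
have alM : forall j, {morph al j : x y / (x * y)%g} by move=> j; case: (alP j).
have lftM : {morph lft : x y / (x * y)%g}.
  move=> x y; apply: p_inj; rewrite ?groupM // pM2 !lftE.
  exact: thetaM.
have clNS j : j \notin S -> cl j = None.
  by move=> jS; apply: clN; rewrite !inE negb_and jS orbT.
have phiM : {morph (fun g => lft g i) : x y / (x * y)%g}.
  by move=> x y; rewrite lftM gpowM.
(* The coordinate [i] of the unique lift is a morphism from a power of the group: it is trivial, or
   a twisted copy of one class [v], which [i] then joins. *)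
have [triv|[v [b [bM b_inj bE]]]] := morph_gpow phiM.
  exists J, cl, al; split=> // g.
  suff -> : theta cl al g = lft g by [].
  apply: gpow_ext => j; rewrite -lftE ffunE; case: eqP => // ->.
  by rewrite triv.
exists J, (fun j => if j == i then Some v else cl j),
  (fun j => if j == i then b else al j); split=> //.
- by move=> j jS; case: eqP => [ji|_]; [rewrite ji iS in jS | apply: clNS].
- move=> v'; have [j cj] := clS v'; exists j; case: eqP => // ji.
  by rewrite ji cliN in cj.
- by move=> j; case: eqP => _; [split|apply: alP].
- move=> g; suff -> : theta (fun j => if j == i then Some v else cl j)
    (fun j => if j == i then b else al j) g = lft g by [].
  apply: gpow_ext => j; rewrite thetaE; case: eqP => [->|/eqP ji] /=; first by rewrite bE.
  by rewrite -thetaE -lftE ffunE (negPf ji).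
Qed.

End Goursat.

(** * Dense edge sets of a rooted multigraph *)

Section Multigraph.
Variables (E V : finType) (src dst : E -> V) (r : V).
Implicit Types (Y : {set E}) (W T : {set V}).

Definition inside Y W := [set e in Y | (src e \in W) && (dst e \in W)].

Definition bnd Y W := [exists e in Y, (src e \in W) != (dst e \in W)].

Definition deg Y v := \sum_(e in Y) ((src e == v) + (dst e == v)).

(** With denominators cleared: the number of new vertices is less than [1 - q / K] times the number
    of new edges. *)
Definition aug K q Y W W2 := (W \subset W2) &&
  (K * #|W2 :\: W| + q * #|inside Y W2 :\: inside Y W|
     < K * #|inside Y W2 :\: inside Y W|).

(* With [beta = K / q]: every rooted vertex set that [Y] leaves can be extended so
   that the new edges of [Y] outnumber the new vertices by more than a fraction
   [1 / beta] of these edges. *)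
Definition good K q Y :=
  [forall W : {set V}, (r \in W) && bnd Y W ==> [exists W2, aug K q Y W W2]].

Definition negl K q := \bigcup_(Y | good K q Y) Y.

Lemma goodP K q Y :
  reflect (forall W, r \in W -> bnd Y W -> exists W2, aug K q Y W W2) (good K q Y).
Proof.
apply: (iffP forallP) => [H W rW bW|H W].
  by have /implyP := H W; rewrite rW bW => /(_ isT) /existsP.
by apply/implyP => /andP[rW bW]; apply/existsP; apply: H.
Qed.

Lemma good0 K q : good K q set0.
Proof. by apply/goodP => W _ /existsP [e]; rewrite inE. Qed.

Lemma bndP Y W :
  reflect (exists2 e, e \in Y & (src e \in W) != (dst e \in W)) (bnd Y W).
Proof. exact: exists_inP. Qed.

(** An edge leaving [W] belongs to [Y1] or [Y2], and the extension for that set serves the union: as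
    [q <= K], further new edges only help. Thus [negl] is the largest good set. *)
Lemma goodU K q Y1 Y2 : q <= K -> good K q Y1 -> good K q Y2 -> good K q (Y1 :|: Y2).
Proof.
move=> le_qK /goodP g1 /goodP g2; apply/goodP => W rW /bndP [e eY ne].
have mono Y W2 : Y \subset Y1 :|: Y2 -> aug K q Y W W2 -> aug K q (Y1 :|: Y2) W W2.
  move=> sY /andP[sW lt]; apply/andP; split=> //; set a := #|_ :\: inside Y W| in lt.
  set b := #|_ :\: inside (Y1 :|: Y2) W|; have le_ab : a <= b.
    apply: subset_leq_card; apply/subsetP => x; rewrite !inE.
    case/andP => H /andP[xY ->]; rewrite xY /= in H; rewrite (negPf H) andbF /=.
    by have := subsetP sY _ xY; rewrite inE => ->.
  by nia.
move: eY; rewrite inE => /orP[] eY.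
  have [|W2 H] := g1 W rW; first by apply/bndP; exists e.
  by exists W2; apply: mono H; apply: subsetUl.
have [|W2 H] := g2 W rW; first by apply/bndP; exists e.
by exists W2; apply: mono H; apply: subsetUr.
Qed.

Lemma good_negl K q : q <= K -> good K q (negl K q).
Proof.
move=> le_qK; apply: (big_ind (good K q)) => //; first exact: good0.
by move=> ? ?; apply: goodU.
Qed.

Lemma good_sub_negl K q Y : good K q Y -> Y \subset negl K q.
Proof. by move=> gY; apply: bigcup_sup. Qed.

Lemma inside_sub Y W W2 : W \subset W2 -> inside Y W \subset inside Y W2.
Proof.
move=> sW; apply/subsetP => e; rewrite !inE => /and3P[-> s d].
by rewrite !(subsetP sW).
Qed.

Lemma card_subD (T : finType) (A B C : {set T}) : A \subset B -> B \subset C ->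
  #|C :\: A| = #|C :\: B| + #|B :\: A|.
Proof.
move=> sAB sBC; have sAC := subset_trans sAB sBC.
have := (subset_leq_card sAB, subset_leq_card sBC).
by rewrite !cardsD !(setIidPr _) // => -[]; lia.
Qed.

(** Extensions are iterated until no edge leaves; their inequalities add up along the chain. *)
Lemma good_closure K q Y W : good K q Y -> r \in W ->
  exists W2, [/\ W \subset W2, ~~ bnd Y W2 & W2 = W \/ aug K q Y W W2].
Proof.
move=> /goodP gY; elim: {W}_.+1 {-2}W (ltnSn (#|V| - #|W|)) => // m IH W ltW rW.
have [bW|nbW] := boolP (bnd Y W); last by exists W; split=> //; left.
have [W1 aug1] := gY W rW bW; have /andP[sW lt1] := aug1.
have ltc : #|W| < #|W1|.
  apply: proper_card; rewrite properEneq sW andbT; apply: contraTneq lt1 => <-.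
  by rewrite !setDv !cards0 !muln0.
have [||W2 [sW12 nb2 H2]] := IH W1; [|exact: (subsetP sW)|].
  by move: ltW ltc (subset_leq_card (subsetT W1)); rewrite cardsT; lia.
exists W2; split=> //; first exact: subset_trans sW12.
right; case: H2 => [->//|/andP[_ lt2]].
rewrite /aug (subset_trans sW sW12) (card_subD sW sW12).
by rewrite (card_subD (inside_sub Y sW) (inside_sub Y sW12)); nia.
Qed.

Lemma deg_gt0 Y v e : e \in Y -> (src e == v) || (dst e == v) -> 0 < deg Y v.
Proof. by move=> eY H; rewrite /deg (bigD1 e) //=; case/orP: H => ->; lia. Qed.

Lemma deg_eq1 Y v : deg Y v = 1 -> exists e, [/\ e \in Y,
  (src e == v) (+) (dst e == v) &
  forall e', e' \in Y -> e' != e -> (src e' != v) && (dst e' != v)].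
Proof.
move=> d1; have [e0 eY pos] : exists2 e, e \in Y & 0 < (src e == v) + (dst e == v).
  apply/exists_inP; rewrite -[X in is_true X]negbK; apply/negP.
  move/exists_inPn => H; suff: deg Y v = 0 by rewrite d1.
  by rewrite /deg big1 // => e eY; have := H e eY; rewrite -eqn0Ngt => /eqP.
exists e0; move: d1; rewrite /deg (bigD1 e0) //=.
set rest := \sum_(e in Y | _) _ => d1.
have rest0 : rest = 0 by lia.
split=> // [|e' e'Y ne]; first by move: d1; rewrite rest0; case: (src e0 == v); case: (dst e0 == v).
move/eqP: rest0; rewrite /rest (bigD1 e') ?e'Y //= addn_eq0 => /andP[+ _].
by case: (src e' == v); case: (dst e' == v).
Qed.

(* Repeatedly deleting an edge with a non-root end of degree one. *)
Lemma trim (P : {set E} -> Prop) Y0 :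
  (forall Y e v, P Y -> v != r -> e \in Y -> (src e == v) (+) (dst e == v) ->
     (forall e', e' \in Y -> e' != e -> (src e' != v) && (dst e' != v)) ->
     P (Y :\ e)) ->
  P Y0 ->
  exists Y, [/\ Y \subset Y0, P Y, forall v, v != r -> deg Y v <> 1 &
    forall T, #|inside (Y0 :\: Y) T| <= #|[set v in T | (v != r) && (deg Y v == 0)]|].
Proof.
move=> del PY0.
(* The extra condition [deg Y0 v != 0] makes the induction count: the vertex isolated by a deletion
   is not among those counted for the smaller set, so it can be charged to the deleted edge. *)
suff [Y [sY PY dY cT]] : exists Y, [/\ Y \subset Y0, P Y,
    forall v, v != r -> deg Y v <> 1 & forall T, #|inside (Y0 :\: Y) T| <=
      #|[set v in T | [&& v != r, deg Y v == 0 & deg Y0 v != 0]]|].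
  exists Y; split=> // T; apply: leq_trans (cT T) _; apply: subset_leq_card.
  by apply/subsetP => v; rewrite !inE => /and4P[-> -> ->].
elim: {Y0}_.+1 {-2}Y0 (ltnSn #|Y0|) PY0 => // m IH Y0 ltY PY0.
have [/existsP [v /andP[vr /eqP d1]]|none] := boolP [exists v, (v != r) && (deg Y0 v == 1)];
  last first.
  exists Y0; split=> // [v vr d1|T].
    by case/negP: none; apply/existsP; exists v; rewrite vr d1.
  by rewrite setDv (_ : inside _ _ = set0) ?cards0 //; apply/setP => e; rewrite !inE.
have [e [eY xe oe]] := deg_eq1 d1.
have [||Y [sY PY dY cT]] := IH (Y0 :\ e).
- by move: ltY; rewrite (cardsD1 e) eY.
- exact: del xe oe.
have dv0 : deg (Y0 :\ e) v = 0.
  rewrite /deg big1 // => e'; rewrite !inE => /andP[ne e'Y].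
  by have /andP[/negPf -> /negPf ->] := oe e' e'Y ne.
have le_deg (Z Z' : {set E}) w : Z \subset Z' -> deg Z w <= deg Z' w.
  move=> sZ; rewrite /deg [X in _ <= X](bigID (mem Z)) /=.
  rewrite (eq_bigl (fun e => (e \in Z') && (e \in Z))) ?leq_addr // => x.
  by case xZ: (x \in Z); rewrite ?andbF // (subsetP sZ).
exists Y; split=> //; first by apply: subset_trans sY (subsetDl _ _).
have sD : Y0 :\ e \subset Y0 by apply: subsetDl.
move=> T; set B := [set v in T | _].
set A := inside _ T; have := cT T.
set A' := inside _ T; set B' := [set v in T | _] => leA'.
have sB : B' \subset B.
  apply/subsetP => w; rewrite !inE => /and4P[-> -> -> d] /=.
  by rewrite -lt0n; apply: leq_trans (le_deg _ _ w sD); rewrite lt0n.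
have sA : A \subset e |: A'.
  by apply/subsetP => x; rewrite !inE; case: eqP => //= _ /and3P[/andP[-> ->] -> ->].
have [eA|neA] := boolP (e \in A); last first.
  have sAA' : A \subset A'.
    apply/subsetP => x xA; have := subsetP sA _ xA; rewrite !inE => /orP[/eqP xe'|//].
    by rewrite -xe' xA in neA.
  exact: leq_trans (subset_leq_card sAA') (leq_trans leA' (subset_leq_card sB)).
have vT : v \in T.
  move: eA; rewrite !inE => /and3P[_ sT dT].
  by move: xe; case: eqP => [<- //|_]; case: eqP => [<- //|].
have vB : v \in B.
  rewrite !inE vT vr d1 /= andbT; have := le_deg _ _ v sY.
  by rewrite dv0 leqn0.
have vB' : v \notin B' by rewrite !inE dv0 eqxx /= !andbF.
apply: leq_trans (subset_leq_card sA) _.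
apply: leq_trans (leq_card_setU _ _) _; rewrite cards1 add1n.
apply: (@leq_trans #|v |: B'|); first by rewrite cardsU1 vB'.
by apply: subset_leq_card; rewrite subUset sub1set vB.
Qed.

End Multigraph.

(** Put [b = v + d + 1]. The hypotheses give [q (t + 1) b < K (d + 1 + t)], and
    [d + 1 + t <= (d + 1) (t + 1)] allows division by [t + 1]. The strict inequality [v < b] is what
    absorbs the [t] lost vertices. *)
Lemma quotient_arith K q t v b z n1 v' :
  v < b -> n1 <= b + z -> z + v <= v' + t -> q * t.+1 < K ->
  K * v' + q * t.+1 * n1 < K * n1 \/ n1 = 0 /\ v' = 0 ->
  K * v + q * b < K * b.
Proof.
move=> lt_vb le_n1 le_v lt_qK base.
have [d Ed] : exists d, b = v + d.+1 by exists (b - v).-1; lia.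
have h1 : K * v' + q * t.+1 * (b + z) < K * (b + z).
  case: base => [H|[_ ->]]; last first.
    by rewrite muln0 add0n ltn_pmul2r //; lia.
  rewrite -(subnKC le_n1) !mulnDr addnA -addSn leq_add //.
  by rewrite leq_mul2r (ltnW lt_qK) orbT.
have h0 : K * (z + v) <= K * (v' + t) by rewrite leq_mul2l le_v orbT.
have h2 : q * t.+1 * b < K * (d.+1 + t).
  move: h1 h0; rewrite !mulnDr Ed !mulnDr; lia.
have h3 : q * b < K * d.+1.
  rewrite -(ltn_pmul2r (ltn0Sn t)) -mulnA [b * _]mulnC mulnA.
  apply: leq_trans h2 _; rewrite -mulnA leq_mul2l; apply/orP; right.
  by rewrite mulSn mulnS; lia.
by move: h3; rewrite Ed !mulnDr; lia.
Qed.

(** * Density pulled back from a quotient graph *)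

Section Quotient.
Variables (E V V' : finType) (src dst : E -> V) (r : V) (pi : V -> V').
Hypothesis pi_surj : forall w, exists v, pi v = w.
Variables (K q t : nat).
Hypothesis card_V : #|V| <= #|V'| + t.
Hypothesis lt_qK : q * t.+1 < K.

(** The fibres over the complement of [W'] are nonempty, so at most [t] surplus vertices remain for
    those over [W']. *)
Lemma card_fiber (W' : {set V'}) : #|pi @^-1: W'| <= #|W'| + t.
Proof.
have le (A : {set V'}) : #|A| <= #|pi @^-1: A|.
  apply: leq_trans (leq_imset_card pi _); apply: subset_leq_card.
  apply/subsetP => w wA; have [v Ev] := pi_surj w.
  by apply/imsetP; exists v; rewrite // inE Ev.
have := le (~: W'); have := cardsC W'; have := cardsC (pi @^-1: W').
have -> : ~: (pi @^-1: W') = pi @^-1: (~: W') by apply/setP => v; rewrite !inE.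
by move: card_V; lia.
Qed.

(** The image of [W] is closed up in the quotient using density of [N], and the closure is pulled
    back. Edges of [N] outside [Y] are paid for by vertices isolated in [Y], and the minimum degree
    two of the other new vertices makes new edges outnumber new vertices. *)
Lemma good_quotient (N Y : {set E}) :
  good (pi \o src) (pi \o dst) (pi r) K (q * t.+1) N -> Y \subset N ->
  (forall v, v != r -> deg src dst Y v <> 1) ->
  (forall T, #|inside src dst (N :\: Y) T| <=
             #|[set v in T | (v != r) && (deg src dst Y v == 0)]|) ->
  good src dst r K q Y.
Proof.
move=> gN sYN dY trimN; apply/goodP => W rW /bndP [e0 e0Y ne0].
have [VY VYE] : exists VY : {set V},
    forall v, (v \in VY) = (v == r) || (deg src dst Y v != 0).
  by exists [set v | (v == r) || (deg src dst Y v != 0)] => v; rewrite inE.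
have endsVY e : e \in Y -> (src e \in VY) && (dst e \in VY).
  by move=> eY; rewrite !VYE -!lt0n !(@deg_gt0 _ _ _ _ _ _ e) ?eqxx ?orbT.
(* Discarding the vertices isolated in [Y] keeps the edges of [Y] inside [W], and leaves only new
   vertices of degree at least two to count. *)
have [W0 W0E] : exists W0 : {set V}, forall v, (v \in W0) = (v \in W) && (v \in VY).
  by exists (W :&: VY) => v; rewrite inE.
pose W' := pi @: W0.
have rW0 : r \in W0 by rewrite W0E VYE rW eqxx.
have rW' : pi r \in W' by apply: imset_f.
have [Wc [sWc nb Hc]] := good_closure gN rW'.
have [W2 W2E] : exists W2 : {set V}, forall v, (v \in W2) = (pi v \in Wc) && (v \in VY).
  by exists (pi @^-1: Wc :&: VY) => v; rewrite !inE.
have sW02 : W0 \subset W2.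
  apply/subsetP => v vW; rewrite W2E (subsetP sWc) ?imset_f //=.
  by move: vW; rewrite W0E => /andP[].
have nbY e : e \in Y -> (src e \in W2) = (dst e \in W2).
  move=> eY; have /andP[s d] := endsVY e eY.
  rewrite !W2E s d !andbT; apply/eqP; apply: contraR nb => ne.
  by apply/bndP; exists e; rewrite ?(subsetP sYN).
set I := inside src dst.
have inW0 e : e \in Y -> forall v, v = src e \/ v = dst e -> (v \in W) = (v \in W0).
  move=> eY v Hv; rewrite W0E; have /andP[s d] := endsVY e eY.
  by case: Hv => ->; rewrite ?s ?d andbT.
have IW0 : I Y W = I Y W0.
  apply/setP => e; rewrite !in_set; case eY: (e \in Y) => //=.
  by rewrite (inW0 _ eY _ (or_introl erefl)) (inW0 _ eY _ (or_intror erefl)).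
pose b := #|I Y W2 :\: I Y W0|; pose v := #|W2 :\: W0|.
(* Handshake: new vertices have degree at least two, and [e0] has an old end. *)
have lt_vb : v < b.
  have le2v : 2 * v <= \sum_(w in W2 :\: W0) deg src dst Y w.
    rewrite mulnC -sum_nat_const; apply: leq_sum => w; rewrite in_setD W2E.
    case/and3P=> nw _ wVY.
    have wr : w != r by apply: contraNneq nw => ->.
    by have := dY w wr; move: wVY; rewrite VYE (negPf wr) /=; case: (deg _ _ _ _) => [|[]].
  have Edeg : \sum_(w in W2 :\: W0) deg src dst Y w =
      \sum_(e in Y) ((src e \in W2 :\: W0) + (dst e \in W2 :\: W0)).
    rewrite exchange_big /=; apply: eq_bigr => e _; rewrite big_split /=.
    have cnt (u : V) : \sum_(w in W2 :\: W0) (u == w : nat) = (u \in W2 :\: W0).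
      case uA: (u \in _).
        by rewrite (bigD1 u) //= eqxx big1 // => w /andP[_ /negPf]; rewrite eq_sym => ->.
      by rewrite big1 // => w wA; case: eqP => // uw; rewrite uw wA in uA.
    by rewrite !cnt.
  have e0I : e0 \in I Y W2 :\: I Y W0.
    have Enb := nbY _ e0Y; rewrite in_setD !in_set e0Y /= Enb andbb.
    move: ne0; rewrite (inW0 _ e0Y _ (or_introl erefl)) (inW0 _ e0Y _ (or_intror erefl)).
    case s0: (src e0 \in W0); case d0: (dst e0 \in W0) => //= _.
      by rewrite -Enb (subsetP sW02).
    exact: (subsetP sW02).
  have b_gt0 : 0 < b by rewrite card_gt0; apply/set0Pn; exists e0.
  (* A counted edge has at most two new ends, and [e0] at most one; the other edges of [Y] have
     none, because no edge of [Y] leaves [W2]. *)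
  have le2b : \sum_(e in Y) ((src e \in W2 :\: W0) + (dst e \in W2 :\: W0)) <= 2 * b - 1.
    rewrite (bigID (mem (I Y W2 :\: I Y W0))) /= [X in _ + X]big1 ?addn0; last first.
      move=> e /andP[eY]; rewrite !in_setD !in_set eY /=.
      rewrite (nbY _ eY).
      by case: (dst e \in W2); rewrite ?andbF // !andbT negbK => /andP[-> ->].
    rewrite (bigD1 e0) /=; last by rewrite e0Y.
    have le1 : (src e0 \in W2 :\: W0) + (dst e0 \in W2 :\: W0) <= 1.
      move: ne0; rewrite (inW0 _ e0Y _ (or_introl erefl)) (inW0 _ e0Y _ (or_intror erefl)).
      by rewrite !in_setD; case: (src e0 \in W0); case: (dst e0 \in W0) => //= _;
        case: (_ \in _).
    have le_rest : \sum_(e in Y | (e \in I Y W2 :\: I Y W0) && (e != e0))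
        ((src e \in W2 :\: W0) + (dst e \in W2 :\: W0)) <= 2 * (b - 1).
      apply: (@leq_trans (\sum_(e in Y | (e \in I Y W2 :\: I Y W0) && (e != e0)) 2)).
        by apply: leq_sum => e _; do 2 case: (_ \in _).
      rewrite sum_nat_const mulnC leq_mul2l /=.
      have -> : b - 1 = #|(I Y W2 :\: I Y W0) :\ e0|.
        by rewrite /b (cardsD1 e0) e0I add1n subn1.
      apply: subset_leq_card; apply/subsetP => e; rewrite unfold_in => /and3P[_ eI ne].
      by rewrite in_setD1 ne.
    rewrite (eq_bigl (fun e => (e \in Y) && ((e \in I Y W2 :\: I Y W0) && (e != e0))));
      last by move=> e; rewrite andbA.
    by move: le1 le_rest b_gt0; clear; lia.
  by move: le2v le2b b_gt0; rewrite Edeg; clear; lia.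
pose Wh := pi @^-1: Wc.
pose z := #|[set v in Wh | (v != r) && (deg src dst Y v == 0)]|.
pose I' := inside (pi \o src) (pi \o dst).
pose n1 := #|I' N Wc :\: I' N W'|; pose v' := #|Wc :\: W'|.
have le_n1 : n1 <= b + z.
  have sI : I' N W' \subset I' N Wc by apply: inside_sub.
  have E1 : n1 + #|I' N W'| = #|I' N Wc|.
    by rewrite addnC -(cardsID (I' N W') (I' N Wc)) (setIidPr sI).
  have E2 : b + #|I Y W0| = #|I Y W2|.
    by rewrite addnC -(cardsID (I Y W0) (I Y W2)) (setIidPr (inside_sub _ _ _ sW02)).
  have le1 : #|I Y W0| <= #|I' N W'|.
    apply: subset_leq_card; apply/subsetP => e; rewrite in_set => /and3P[eY s d].
    by rewrite in_set (subsetP sYN) //=; apply/andP; split; apply: imset_f.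
  have le2 : #|I' N Wc| <= #|I Y W2| + z.
    apply: leq_trans (leq_add (leqnn _) (trimN Wh)).
    apply: leq_trans (leq_card_setU _ _); apply: subset_leq_card.
    apply/subsetP => e; rewrite in_set => /and3P[eN s d].
    rewrite in_setU !in_set eN; case eY: (e \in Y) => /=; last by rewrite s d.
    have /andP[sV dV] := endsVY _ eY.
    by rewrite !W2E sV dV !andbT; apply/orP; left; apply/andP.
  by move: E1 E2 le1 le2; clear; lia.
have le_v : z + v <= v' + t.
  have E1 : #|Wh| = z + #|W2|.
    rewrite -(cardsID VY Wh) addnC; congr (_ + _); apply: eq_card => w; last first.
      by rewrite !in_set W2E.
    by rewrite in_setD VYE negb_or negbK andbC [RHS]in_set.
  have E2 : v + #|W0| = #|W2| by rewrite addnC -(cardsID W0 W2) (setIidPr sW02).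
  have E3 : v' + #|W'| = #|Wc| by rewrite addnC -(cardsID W' Wc) (setIidPr sWc).
  have := card_fiber Wc; have := leq_imset_card pi W0; rewrite -/Wh -/W'.
  by move: E1 E2 E3; clear; lia.
have main : K * v + q * b < K * b.
  apply: quotient_arith lt_vb le_n1 le_v lt_qK _.
  case: Hc => [Ec|/andP[_ //]]; last by left.
  by right; rewrite /n1 /v' Ec !setDv !cards0.
exists (W :|: W2); apply/andP; split; first exact: subsetUl.
have le_w : #|(W :|: W2) :\: W| <= v.
  rewrite setDUl setDv set0U; apply: subset_leq_card; apply/subsetP => w.
  rewrite !in_setD => /andP[nw ->]; rewrite andbT; apply: contra nw.
  by rewrite W0E => /andP[].
have le_b : b <= #|inside src dst Y (W :|: W2) :\: inside src dst Y W|.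
  apply: subset_leq_card; rewrite -/I IW0; apply: setSD.
  by apply: inside_sub; apply: subsetUr.
move: le_w le_b main; set w := #|_ :\: W|; set c := #|_ :\: inside _ _ _ _|.
move=> le_w le_b main; apply: leq_ltn_trans (leq_add (leq_mul (leqnn K) le_w) (leqnn _)) _.
have le_qK : q <= K by apply: leq_trans (ltnW lt_qK); rewrite leq_pmulr.
rewrite -(subnKC le_b) !mulnDr addnA -addSn leq_add //.
by rewrite leq_mul2r le_qK orbT.
Qed.

End Quotient.

(** * The gauge action *)

Section Gauge.
Variables (m : nat) (gT : finGroupType).
Local Notation aT := (gpow 'I_m gT).
Local Notation X := (gpow 'I_m.+1 gT).
Local Open Scope group_scope.

(* The position [i] of the word joins two vertices of a cycle of length [m.+1],
   whose root [None] carries no group factor. *)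
Definition esrc (i : 'I_m.+1) : option 'I_m := unlift ord0 i.
Definition edst (i : 'I_m.+1) : option 'I_m := unlift ord0 (ordS i).

Definition gv (u : aT) (o : option 'I_m) : gT := oapp u 1 o.

Definition gact (u : aT) (h : X) : X :=
  [ffun i => gv u (esrc i) * h i * (gv u (edst i))^-1].

Lemma gvM u v o : gv (u * v) o = gv u o * gv v o.
Proof. by case: o => [j|] /=; rewrite ?mulg1 // gpowM. Qed.

Lemma gvV u o : gv u^-1 o = (gv u o)^-1.
Proof. by case: o => [j|] /=; rewrite ?invg1 // gpowV. Qed.

Lemma gactE u h i : gact u h i = gv u (esrc i) * h i * (gv u (edst i))^-1.
Proof. by rewrite ffunE. Qed.

Lemma gactM u v h : gact (u * v) h = gact u (gact v h).
Proof. by apply: gpow_ext => i; rewrite !gactE !gvM invMg !mulgA. Qed.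

Lemma sum_gact (U : {group aT}) (f : X -> nat) u x : u \in U ->
  (\sum_(w in U) f (gact w (gact u x)) = \sum_(w in U) f (gact w x))%N.
Proof.
move=> uU; rewrite [RHS](reindex_inj (mulIg u)) /=; apply: eq_big => w.
  by rewrite groupMr.
by rewrite gactM.
Qed.

Definition ab_rel (U : {group aT}) (q : nat) (x y : X) := forall A : {set 'I_m.+1},
  (#|A| * q < m.+1)%N -> exists2 u, u \in U & forall i, i \in A -> gact u x i = y i.

(** Some letter [e] is missed by [A]. The gauge element equal to [g^-1] at the vertices [1] to [e]
    creates [g] at letter [0] and hides its inverse at letter [e]. *)
Lemma ab_root (g : gT) : ab_rel [set: aT]%G 1 1 (sgl ord0 g).
Proof.
move=> A; rewrite muln1 => ltA.
have [e neA] : exists e, e \notin A.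
  apply/existsP; rewrite -negb_forall; apply: contraL ltA => /forallP all_A.
  by rewrite -leqNgt -[X in (X <= _)%N]card_ord subset_leq_card //; apply/subsetP => i _; apply: all_A.
pose u : aT := [ffun j : 'I_m => if (j < e)%N then g^-1 else 1].
exists u; rewrite ?inE // => i iA.
have ie : i != e by apply: contraNneq neA => <-.
have gvE (i' : 'I_m.+1) : gv u (unlift ord0 i') = if (0 < i' <= e)%N then g^-1 else 1.
  by case: unliftP => [j|] -> //=; rewrite ffunE.
rewrite gactE sglE gpow1 mulg1 /esrc /edst !gvE -val_eqE /=.
move: ie; rewrite -val_eqE /= => ie; have lt_i := ltn_ord i; have lt_e := ltn_ord e.
have [im|ltim] := eqVneq (i : nat) m.
  have c1 : (0 < m <= e)%N = false by lia.
  have c2 : (m == 0)%N = false by lia.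
  by rewrite im modnn c1 c2 /= invg1 mulg1.
rewrite modn_small; last by lia.
have [i0|ipos] := eqVneq (i : nat) 0%N.
  have c1 : (0 < 1 <= e)%N by lia.
  by rewrite i0 c1 /= mul1g invgK.
have -> : (0 < i.+1 <= e)%N = (0 < i <= e)%N by lia.
by rewrite mulgV.
Qed.

(** * Cyclic groups of prime order *)

Section Abelian.
Variables (n p : nat).
Hypothesis pr_p : prime p.
Hypothesis card_gT : #|gT| = p.
Hypothesis le_np : (n <= p)%N.
Hypothesis comm_gT : forall x y : gT, commute x y.

Lemma comm_gpow (u v : aT) : commute u v.
Proof. by apply: gpow_ext => i; rewrite !gpowM comm_gT. Qed.

Lemma gact_fix u h i : (gact u h i == h i) = (gv u (esrc i) == gv u (edst i)).
Proof.
rewrite gactE (comm_gT _ (h i)) -mulgA -{2}[h i]mulg1 (inj_eq (mulgI _)).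
by rewrite -eq_mulgV1.
Qed.

Lemma gact_comm u v h : gact u (gact v h) = gact v (gact u h).
Proof. by rewrite -!gactM comm_gpow. Qed.

Lemma card_pnat (U : {group aT}) : p.-nat #|U|.
Proof.
apply: (@pnat_dvd _ #|[set: aT]|); first by rewrite cardSg ?subsetT.
by rewrite cardsT card_ffun card_gT pnatX pnat_id.
Qed.

Lemma proper_card_p (H U : {group aT}) : H \proper U -> (p * #|H| <= #|U|)%N.
Proof.
move=> /properP [sHU [u uU nuH]]; rewrite -(Lagrange sHU) mulnC leq_mul2l.
apply/orP; right; have : p.-nat #|U : H|.
  by apply: pnat_dvd (card_pnat U); apply: dvdn_indexg.
case/p_natP => -[|j] Ej.
  by move/eqP: Ej; rewrite expn0 indexg_eq1 => /subsetP/(_ u uU); rewrite (negPf nuH).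
by rewrite Ej expnS leq_pmulr // expn_gt0 prime_gt0.
Qed.

(** By [gact_fix], these are the elements of [U] that fix the letters in [A] of every word. *)
Definition ab_fix (U : {group aT}) (A : {set 'I_m.+1}) :=
  [set u in U | [forall i in A, gv u (esrc i) == gv u (edst i)]].

Lemma ab_fixP (U : {group aT}) (A : {set 'I_m.+1}) u : reflect (u \in U /\ forall i, i \in A -> gv u (esrc i) = gv u (edst i))
  (u \in ab_fix U A).
Proof.
rewrite inE; apply: (iffP andP) => -[uU H]; split=> //.
  by move=> i iA; apply/eqP; have /forall_inP/(_ i iA) := H.
by apply/forall_inP => i iA; rewrite H.
Qed.

Lemma ab_fix_group_set U A : group_set (ab_fix U A).
Proof.
apply/group_setP; split.
  by apply/ab_fixP; split=> // i _; rewrite -(mulgV 1) !gvM !gvV !mulgV.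
move=> u v /ab_fixP [uU Hu] /ab_fixP [vU Hv]; apply/ab_fixP; split.
  exact: groupM.
by move=> i iA; rewrite (gvM u v (esrc i)) (gvM u v (edst i)) (Hu i iA) (Hv i iA).
Qed.
Canonical ab_fix_group U A := group (ab_fix_group_set U A).

Lemma mem_join (H U : {group aT}) u :
  reflect (exists a b, [/\ a \in H, b \in U & u = a * b]) (u \in H <*> U).
Proof.
have cHU : U \subset 'C(H).
  by apply/subsetP => x _; apply/centP => y _; apply: comm_gpow.
rewrite cent_joinEr //; apply: (iffP mulsgP) => [[a b aH bU ->]|[a [b [aH bU ->]]]].
  by exists a, b.
by exists a b.
Qed.

(* Each small set that still separates cosets of [U'] costs a factor [p] in the
   index, so at most [t] of them need to be collected. *)
Lemma ab_saturate (U U' : {group aT}) t q : U' \subset U -> #|U : U'| = (p ^ t)%N ->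
  exists Y : {set 'I_m.+1}, (#|Y| * q <= t * m.+1)%N /\
    forall A : {set 'I_m.+1}, (#|A| * q < m.+1)%N -> ab_fix U Y \subset ab_fix U A <*> U'.
Proof.
move=> sU' idx.
have le_t s (Y : {set 'I_m.+1}) : (p ^ s * #|ab_fix U Y <*> U'| <= #|U|)%N -> (s <= t)%N.
  move=> leU; rewrite -(leq_exp2l _ _ (prime_gt1 pr_p)).
  rewrite -(leq_pmul2r (cardG_gt0 U')) -idx [X in (_ <= X)%N]mulnC Lagrange //.
  by apply: leq_trans leU; rewrite leq_mul2l subset_leq_card ?orbT ?joing_subr.
(* Here [s] counts the sets collected into [Y], each of fewer than [m.+1 / q] letters and each
   costing a factor [p]; [d] bounds the number still to come. *)
suff main d : forall s (Y : {set 'I_m.+1}), (t - s < d)%N -> (#|Y| * q <= s * m.+1)%N ->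
    (p ^ s * #|ab_fix U Y <*> U'| <= #|U|)%N ->
    exists Y : {set 'I_m.+1}, (#|Y| * q <= t * m.+1)%N /\
    forall A : {set 'I_m.+1}, (#|A| * q < m.+1)%N -> ab_fix U Y \subset ab_fix U A <*> U'.
  apply: (main (t - 0).+1 0%N set0) => //; first by rewrite cards0.
  rewrite expn0 mul1n; apply: subset_leq_card; rewrite join_subG sU' andbT.
  by apply/subsetP => u /ab_fixP [].
elim: d => // d IH s Y lt_d leY leU.
have [/forallP stable|/forallPn [A]] := boolP [forall A : {set 'I_m.+1},
  (#|A| * q < m.+1)%N ==> (ab_fix U Y \subset ab_fix U A <*> U')].
  exists Y; split; last by move=> A HA; have := stable A; rewrite HA.
  by apply: leq_trans leY _; rewrite leq_mul2r (le_t _ _ leU) orbT.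
rewrite negb_imply => /andP[smallA nsub].
have sYA : ab_fix U (Y :|: A) \subset ab_fix U Y.
  apply/subsetP => u /ab_fixP [uU Hu]; apply/ab_fixP; split=> // i iY.
  by apply: Hu; rewrite inE iY.
have sAA : ab_fix U (Y :|: A) \subset ab_fix U A.
  apply/subsetP => u /ab_fixP [uU Hu]; apply/ab_fixP; split=> // i iY.
  by apply: Hu; rewrite inE iY orbT.
have prop : ab_fix U (Y :|: A) <*> U' \proper ab_fix U Y <*> U'.
  rewrite properEneq genS ?setSU // andbT; apply: contra nsub => /eqP E.
  by apply: subset_trans (joing_subl (ab_fix U Y) U') _; rewrite -E genS // setSU.
have leP := @proper_card_p (ab_fix_group U (Y :|: A) <*> U')%G (ab_fix_group U Y <*> U')%G prop.
have leU1 : (p ^ s.+1 * #|ab_fix U (Y :|: A) <*> U'| <= #|U|)%N.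
  apply: leq_trans leU; rewrite expnSr -mulnA leq_mul2l; apply/orP; right.
  exact: leP.
apply: (IH s.+1 (Y :|: A)) => //; first by have := le_t _ _ leU1; lia.
apply: leq_trans (leq_mul (leq_card_setU Y A) (leqnn q)) _.
by rewrite mulnDl mulSn addnC leq_add // ltnW.
Qed.

(** Let [u] match [x] with [y] on the saturated set [Y]. A set [A] small at the new scale leaves
    [Y :|: A] small at the old one, so some [w] matches both there. Then [w * u^-1] fixes [Y] and
    factors as [a * b] with [a] fixing [A] and [b] in [U], so [b] matches [gact u x] with [y] on
    [A]. *)
Lemma ab_step (s U : {group aT}) : U \subset s ->
  exists t (s' : {group aT}), [/\ (n ^ t <= #|s : U|)%N, s' \subset U &
    forall q (f : X -> bool) x y, (q * t.+1 < m.+1)%N -> ab_rel s q x y ->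
      (\sum_(u in s) (f (gact u x) : nat) <> \sum_(u in s) (f (gact u y) : nat))%N ->
      exists x' y', ab_rel s' (q * t.+1) x' y' /\ f x' <> f y'].
Proof.
move=> sU; have : p.-nat #|s : U|.
  by apply: pnat_dvd (card_pnat s); apply: dvdn_indexg.
case/p_natP => t idx; exists t, U; split=> //.
  by rewrite idx; elim: t {idx} => // t IH; rewrite !expnS leq_mul.
move=> q f x y lt_q Rxy neq.
have [Y [leY satY]] := ab_saturate (q * t.+1)%N sU idx.
have ltY : (#|Y| * q < m.+1)%N.
  rewrite -(ltn_pmul2r (ltn0Sn t)) -mulnA; apply: leq_ltn_trans leY _.
  by rewrite mulnC ltn_pmul2l.
have [u us uY] := Rxy Y ltY.
have relU (A : {set 'I_m.+1}) : (#|A| * (q * t.+1) < m.+1)%N ->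
    exists2 b, b \in U & forall i, i \in A -> gact b (gact u x) i = y i.
  move=> smallA.
  have ltYA : (#|Y :|: A| * q < m.+1)%N.
    rewrite -(ltn_pmul2r (ltn0Sn t)) -mulnA.
    have := leq_mul (leq_card_setU Y A) (leqnn (q * t.+1)%N).
    by rewrite mulnDl => H; apply: leq_ltn_trans H _; rewrite mulnS; lia.
  have [w ws wYA] := Rxy _ ltYA.
  have /mem_join [a [b [/ab_fixP [_ aA] bU Eab]]] : w * u^-1 \in ab_fix_group s A <*> U.
    apply: (subsetP (satY A smallA)); apply/ab_fixP; split; first by rewrite groupM ?groupV.
    move=> i iY; apply/eqP; rewrite -(gact_fix _ (gact u x)) -gactM mulgKV.
    by rewrite wYA ?uY // inE iY.
  exists b => // i iA; rewrite -(wYA i) ?inE ?iA ?orbT //.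
  rewrite -[w](mulgKV u) Eab -mulgA gactM; symmetry; apply/eqP.
  by rewrite (gactM b u) gact_fix aA.
have [w [ws fw]] : exists w, w \in s /\ f (gact w (gact u x)) <> f (gact w y).
  apply: NNPP => none; apply: neq; rewrite -(sum_gact (fun z => f z : nat) x us).
  apply: eq_bigr => w ws; congr nat_of_bool; apply: NNPP => ne; apply: none.
  by exists w.
exists (gact w (gact u x)), (gact w y); split=> // A smallA.
have [b bU Hb] := relU A smallA; exists b => // i iA.
by rewrite gact_comm !(gactE w) Hb.
Qed.

Lemma ab_leaf (s : {group aT}) q x y (f : X -> bool) (i : 'I_m.+1) :
  (q < m.+1)%N -> ab_rel s q x y ->
  (forall u z, u \in s -> f (gact u z) = f z) ->
  (forall z z' : X, z i = z' i -> f z = f z') -> f x = f y.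
Proof.
move=> lt_q Rxy inv dep; have [|u us Hu] := Rxy [set i]; first by rewrite cards1 mul1n.
by rewrite -(inv u x us); apply: dep; rewrite Hu ?set11.
Qed.

End Abelian.
End Gauge.

(** * Non-abelian simple groups *)

Section NonAbelian.
Variables (m n : nat) (gT : finGroupType).
Local Notation aT := (gpow 'I_m gT).
Local Notation X := (gpow 'I_m.+1 gT).
Local Open Scope group_scope.

(* A power of the group embedded diagonally: the coordinates in the class [v]
   are linked by automorphisms, and those outside every class are trivial. *)
Record cstate := CState {
  cJ : finType;
  ccl : 'I_m -> option cJ;
  cal : 'I_m -> gT -> gT;
  cal_morph : forall i, {morph cal i : x y / x * y};
  cal_inj : forall i, injective (cal i) }.

Definition ctheta s := theta (@ccl s) (@cal s).
Arguments ctheta s g : clear implicits.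

Lemma cthetaM s : {in [set: gpow (cJ s) gT] &, {morph ctheta s : x y / x * y}}.
Proof. by move=> x y _ _; apply: thetaM; apply: cal_morph. Qed.

Canonical ctheta_morphism s := Morphism (@cthetaM s).

Definition cgrp s : {group aT} := (ctheta_morphism s @* [set: gpow (cJ s) gT])%G.

(** Vertices with trivial coordinate are merged with the root [None]. *)
Definition csrc s (i : 'I_m.+1) : option (cJ s) := obind (@ccl s) (esrc i).
Definition cdst s (i : 'I_m.+1) : option (cJ s) := obind (@ccl s) (edst i).

Definition cnegl s q := negl (@csrc s) (@cdst s) None m.+1 q.

Definition crel s (q : nat) (x y : X) := forall i, i \in cnegl s q -> x i = y i.

Lemma mem_cgrp s g : ctheta s g \in cgrp s.
Proof. by apply: (mem_morphim (ctheta_morphism s)); rewrite inE. Qed.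

Lemma gv_sgl s j x o : gv (ctheta s (sgl j x)) o =
  if obind (@ccl s) o == Some j then oapp (fun i => cal s i x) 1 o else 1.
Proof.
case: o => [i|] //=; rewrite thetaE; case Ei: (ccl s i) => [v|] //=.
have c1 : cal s i 1 = 1 by apply: (mulgI (cal s i 1)); rewrite -cal_morph !mulg1.
rewrite sglE (_ : (Some v == Some j) = (v == j)) //.
by case: eqP.
Qed.

Lemma cal_surj s (i : 'I_m) y : exists x, @cal s i x = y.
Proof. by have [c _ cK] := injF_bij (@cal_inj s i); exists (c y). Qed.

(** Exactly one end of [e] lies in class [j] and the twists are onto, so the factor [j] alone gives
    this letter any value; letters not meeting [j] stay fixed. *)
Lemma move_edge s j e (x y : X) :
  (csrc s e == Some j) (+) (cdst s e == Some j) ->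
  exists2 u, u \in cgrp s & gact u x e = y e /\
    forall i, (csrc s i != Some j) && (cdst s i != Some j) -> gact u x i = x i.
Proof.
move=> xe.
have fixed g i : (csrc s i != Some j) && (cdst s i != Some j) ->
    gact (ctheta s (sgl j g)) x i = x i.
  case/andP => /negPf ns /negPf nd; rewrite gactE !gv_sgl -/(csrc s i) -/(cdst s i).
  by rewrite ns nd mul1g invg1 mulg1.
case Es: (csrc s e == Some j) xe => /= Ed.
  have [i Ei] : exists i, esrc e = Some i.
    by move: Es; rewrite /csrc; case: (esrc e) => // i; exists i.
  have [g Eg] := cal_surj s i (y e * (x e)^-1).
  exists (ctheta s (sgl j g)); first exact: mem_cgrp.
  split; last exact: fixed.
  rewrite gactE !gv_sgl -/(csrc s e) -/(cdst s e) Es (negPf Ed) Ei /= Eg.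
  by rewrite invg1 mulg1 mulgKV.
have [i Ei] : exists i, edst e = Some i.
  by move: Ed; rewrite /cdst; case: (edst e) => // i; exists i.
have [g Eg] := cal_surj s i ((y e)^-1 * x e).
exists (ctheta s (sgl j g)); first exact: mem_cgrp.
split; last exact: fixed.
rewrite gactE !gv_sgl -/(csrc s e) -/(cdst s e) Es Ed Ei /= Eg.
by rewrite mul1g invMg invgK mulKVg.
Qed.

(** A letter that is a loop forms a good set by itself, so [x] and [y] agree there; any other letter
    can be gauged from one value to the other. *)
Lemma nab_leaf s q x y (f : X -> bool) (i : 'I_m.+1) :
  crel s q x y ->
  (forall u z, u \in cgrp s -> f (gact u z) = f z) ->
  (forall z z' : X, z i = z' i -> f z = f z') -> f x = f y.
Proof.
move=> Rxy inv dep.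
have [Eq|ne] := eqVneq (csrc s i) (cdst s i).
  apply: dep; apply: Rxy; suff g1 : good (@csrc s) (@cdst s) None m.+1 q [set i].
    by apply: (subsetP (good_sub_negl g1)); rewrite set11.
  by apply/goodP => W _ /bndP [e /set1P ->]; rewrite Eq eqxx.
have [j xj] : exists j, (csrc s i == Some j) (+) (cdst s i == Some j).
  move: ne; case: (csrc s i) => [j|]; case: (cdst s i) => [j'|] //= ne.
  - by exists j; rewrite eqxx eq_sym (negPf ne).
  - by exists j; rewrite eqxx.
  - by exists j'; rewrite eqxx.
have [u us [Eu _]] := move_edge x y xj.
by rewrite -(inv u x us); apply: dep.
Qed.

Definition croot : cstate :=
  @CState 'I_m Some (fun=> id) (fun _ _ _ => erefl) (fun _ => @inj_id gT).

(** The full cycle is not good from the root at scale [m.+1]: taking all vertices adds [m] vertices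
    and [m.+1] edges, which gives equality, and any smaller set adds no more edges than vertices. *)
Lemma negl_croot : (0 < m)%N -> exists e, e \notin cnegl croot 1.
Proof.
move=> m_gt0; apply/existsP; rewrite -negb_forall; apply/negP => /forallP all_negl.
have gT' : good (@csrc croot) (@cdst croot) None m.+1 1 [set: 'I_m.+1].
  suff <- : cnegl croot 1 = [set: 'I_m.+1] by apply: good_negl.
  by apply/setP => e; rewrite inE all_negl.
have csrcE i : csrc croot i = unlift ord0 i by rewrite /csrc /esrc; case: unlift.
have cdstE i : cdst croot i = unlift ord0 (ordS i) by rewrite /cdst /edst; case: unlift.
have ord1_neq0 : ordS (ord0 : 'I_m.+1) != ord0.
  by rewrite -val_eqE /= modn_small.
have [||W2 /andP[sW lt]] := goodP _ _ _ _ _ _ gT' [set None].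
- by rewrite inE.
- apply/bndP; exists ord0; first by rewrite inE.
  rewrite csrcE cdstE unlift_none !inE eqxx.
  by case: unliftP ord1_neq0 => [j ->|-> /eqP].
have NW2 : None \in W2 by apply: (subsetP sW); rewrite set11.
pose T := [set i : 'I_m.+1 | unlift ord0 i \in W2].
have cT : #|T| = #|W2|.
  have -> : W2 = [set unlift ord0 i | i in T].
    apply/setP => o; apply/idP/imsetP => [oW|[i iT ->]]; last by move: iT; rewrite inE.
    exists (oapp (lift ord0) ord0 o); last by case: (o) => [j|] /=; rewrite ?liftK ?unlift_none.
    by rewrite inE; case: (o) oW => [j|] /=; rewrite ?liftK ?unlift_none.
  rewrite card_imset // => i j; case: unliftP => [i'|] ->; case: unliftP => [j'|] -> //.
  by case=> ->.
pose v := #|W2 :\: [set None]|.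
have Ev : #|W2| = v.+1 by rewrite (cardsD1 None) NW2.
set a := #|inside _ _ _ W2 :\: _| in lt.
have le_a : (a <= #|inside (@csrc croot) (@cdst croot) [set: 'I_m.+1] W2|)%N.
  by apply: subset_leq_card; apply: subsetDl.
rewrite -/v mul1n in lt.
have insE i : (i \in inside (@csrc croot) (@cdst croot) [set: 'I_m.+1] W2) =
    (i \in T) && (ordS i \in T) by rewrite !inE csrcE cdstE.
have [/forallP closed|/forallPn [i]] := boolP [forall i, (i \in T) ==> (ordS i \in T)].
  have allT i : i \in T.
    have H j : (j < m.+1)%N -> forall i : 'I_m.+1, i = j :> nat -> i \in T.
      elim: j => [|j IH] ltj i' Ei.
        by rewrite (_ : i' = ord0) ?inE ?unlift_none //; apply: val_inj.
      have ltj' : (j < m.+1)%N by lia.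
      have /implyP/(_ (IH ltj' (Ordinal ltj') erefl)) := closed (Ordinal ltj').
      by rewrite (_ : ordS _ = i') //; apply: val_inj; rewrite /= modn_small ?Ei.
    exact: H (ltn_ord i) i erefl.
  have cT1 : #|T| = m.+1.
    by rewrite -[RHS]card_ord; apply: eq_card => i; rewrite allT.
  have a_le : (a <= m.+1)%N.
    by apply: leq_trans le_a _; rewrite -[X in (_ <= X)%N]card_ord max_card.
  by move: lt a_le cT cT1 Ev; clear; nia.
rewrite negb_imply => /andP[iT niT].
have lt_ins : (a <= v)%N.
  rewrite -ltnS -Ev -cT; apply: leq_ltn_trans le_a _; apply: proper_card.
  apply/properP; split; last by exists i => //; rewrite insE iT.
  by apply/subsetP => e; rewrite insE => /andP[].
by move: lt lt_ins; clear; nia.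
Qed.

Hypothesis simple_gT : simple [set: gT].
Hypothesis nab_gT : ~~ abelian [set: gT].
Hypothesis n_gt0 : (0 < n)%N.
Hypothesis index_gT : forall H : {group gT}, H :!=: [set: gT] -> (n * #|H| <= #|gT|)%N.

(** Goursat's lemma on the preimage of [U] gives the next state, with [t] the number of lost
    classes. If no pair indistinguishable there were separated, the sum [F] would depend only on the
    new negligible set; trimming it gives a set good at the old scale, on which [x] and [y]
    agree. *)
Lemma nab_step s (U : {group aT}) : U \subset cgrp s ->
  exists t s', [/\ (n ^ t <= #|cgrp s : U|)%N, cgrp s' \subset U &
    forall q (f : X -> bool) x y, (q * t.+1 < m.+1)%N -> crel s q x y ->
      (\sum_(u in cgrp s) (f (gact u x) : nat) <>
       \sum_(u in cgrp s) (f (gact u y) : nat))%N ->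
      exists x' y', crel s' (q * t.+1) x' y' /\ f x' <> f y'].
Proof.
move=> sU; pose L := (ctheta_morphism s @*^-1 U)%G.
have [|J [cl [al [_ clS alP thL cardJ]]]] :=
  @goursat gT n simple_gT nab_gT index_gT (cJ s) [set: cJ s] L.
  by move=> l i _; rewrite inE.
have al_morph i : {morph al i : x y / x * y} by case: (alP i).
have al_inj i : injective (al i) by case: (alP i).
pose cl2 i := obind cl (@ccl s i).
(* The default [x] keeps [al2 i] injective when [i] lies in no class. *)
pose al2 i x := cal s i (oapp (fun v => al v x) x (@ccl s i)).
have al2_morph i : {morph al2 i : x y / x * y}.
  by move=> x y; rewrite /al2; case: (ccl s i) => [v|] /=; rewrite ?al_morph cal_morph.
have al2_inj i : injective (al2 i).
  by move=> x y /cal_inj; case: (ccl s i) => [v|] //= /al_inj.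
pose s' := CState cl2 al2_morph al2_inj.
have le_J : (#|J| <= #|cJ s|)%N.
  have imgJ : [set: option J] \subset [set cl i | i : cJ s] :|: [set None].
    apply/subsetP => -[w|] _; rewrite !inE ?orbT //; have [v <-] := clS w.
    by rewrite imset_f.
  have := leq_trans (subset_leq_card imgJ) (leq_card_setU _ _).
  by rewrite cardsT card_option cards1 addn1 ltnS => /leq_trans -> //; rewrite leq_imset_card.
pose t := (#|cJ s| - #|J|)%N.
have idx : (n ^ t <= #|cgrp s : U|)%N.
  have cL : #|L| = (#|'ker (ctheta_morphism s)| * #|U|)%N by apply: card_morphpre.
  have cG : #|[set: gpow (cJ s) gT]| = (#|'ker (ctheta_morphism s)| * #|cgrp s|)%N.
    rewrite card_morphim setIid Lagrange //; exact: subsetT.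
  rewrite -(leq_pmul2l (cardG_gt0 U)) Lagrange //.
  rewrite -(leq_pmul2l (cardG_gt0 ('ker (ctheta_morphism s))%G)) -cG mulnA -cL.
  rewrite -(leq_pmul2l (_ : 0 < n ^ #|J|)%N) ?expn_gt0 ?n_gt0 //.
  rewrite mulnCA -expnD subnKC // mulnC cardsT card_ffun.
  by move: cardJ; rewrite cardsT.
have sgrp : cgrp s' \subset U.
  apply/subsetP => u /morphimP [g _ _ ->] /=.
  have -> : ctheta s' g = ctheta s (theta cl al g).
    apply: gpow_ext => i; rewrite /ctheta !thetaE /= /cl2 /al2.
    case: (ccl s i) => [v|] //=; rewrite thetaE; case: (cl v) => [w|] //=.
    by apply: (mulgI (cal s i 1)); rewrite -cal_morph !mulg1.
  by have /morphpreP [] := thL g.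
exists t, s'; split=> // q f x y lt_q Rxy neq; apply: NNPP => none.
apply: neq; pose pi := obind cl.
have Esrc : @csrc s' = pi \o @csrc s.
  by apply: functional_extensionality => i; rewrite /csrc /pi /=; case: (esrc i).
have Edst : @cdst s' = pi \o @cdst s.
  by apply: functional_extensionality => i; rewrite /cdst /pi /=; case: (edst i).
pose F z := (\sum_(u in cgrp s) (f (gact u z) : nat))%N.
pose P (Y : {set 'I_m.+1}) := forall x y : X, (forall i, i \in Y -> x i = y i) -> F x = F y.
have PN : P (cnegl s' (q * t.+1)).
  move=> z z' Hz; apply: eq_bigr => u _; congr nat_of_bool; apply: NNPP => ne.
  apply: none; exists (gact u z), (gact u z'); split=> // i iN.
  by rewrite !gactE Hz.
(* The gauge factor at [v] resets the letter [e] without changing the other letters of [Y], and [F]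
   is invariant under it. *)
have del (Y : {set 'I_m.+1}) e v : P Y -> v != None -> e \in Y ->
    (csrc s e == v) (+) (cdst s e == v) ->
    (forall e', e' \in Y -> e' != e -> (csrc s e' != v) && (cdst s e' != v)) ->
    P (Y :\ e).
  case: v => // j PY _ eY xe oe z z' Hz.
  have [u us [Ee Ei]] := move_edge z z' xe.
  rewrite -[LHS](sum_gact (fun z => f z : nat) z us); apply: PY => i iY.
  have [->//|ne] := eqVneq i e; rewrite Ei ?oe //.
  by apply: Hz; rewrite !inE ne.
have [Y [sYN PY dY trimY]] := trim del PN.
apply: PY => i iY; apply: Rxy.
suff gY : good (@csrc s) (@cdst s) None m.+1 q Y by apply: (subsetP (good_sub_negl gY)).
apply: (@good_quotient _ _ _ _ _ _ pi _ _ _ t _ lt_q (cnegl s' (q * t.+1))) => //.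
- by case=> [w|]; [have [v <-] := clS w; exists (Some v)|exists None].
- by rewrite !card_option /t; lia.
- rewrite -Esrc -Edst; apply: good_negl; exact: ltnW.
Qed.

End NonAbelian.

(** * The word problem *)

Section MinimalDegree.
Variables (gT : finGroupType) (n : nat).
Hypothesis simple_gT : simple [set: gT].
Hypothesis min_gT :
  forall (m : nat) (K : {group {perm 'I_m}}), K \isog [set: gT] -> n <= m.

(** The action on the right cosets of [H] has a normal kernel. By simplicity it is faithful, of
    degree the index of [H], unless the kernel is everything, which would force [H] to be the whole
    group. *)
Lemma index_ge_min_degree (H : {group gT}) : H :!=: [set: gT] -> n * #|H| <= #|gT|.
Proof.
move=> nH; pose C := rcosets H [set: gT].
have HC : (H : {set gT}) \in C by apply/rcosetsP; exists 1%g; rewrite ?inE ?mulg1.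
have CM (A : {set gT}) x : A \in C -> (A :* x)%g \in C.
  by case/rcosetsP => y _ ->; rewrite -rcosetM -rcosetE imset_f ?inE.
pose f x (i : 'I_#|C|) : 'I_#|C| := enum_rank_in HC (enum_val i :* x)%g.
have fE x i : enum_val (f x i) = (enum_val i :* x)%g.
  by rewrite enum_rankK_in // CM // enum_valP.
have f_inj x : injective (f x).
  move=> i j /(congr1 enum_val); rewrite !fE => Eij; apply: enum_val_inj.
  by rewrite -[LHS]rcoset1 -(mulgV x) rcosetM Eij -rcosetM mulgV rcoset1.
pose phi x := perm (f_inj x).
have phiM : {in [set: gT] &, {morph phi : x y / (x * y)%g}}.
  move=> x y _ _; apply/permP => i; apply: enum_val_inj.
  by rewrite permM !permE !fE rcosetM.
pose phim := Morphism phiM.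
have inj_phi : ('injm phim)%g.
  have [x y|/= K1|/= KT] := @normal_trivial _ simple_gT ('ker phim)%G.
  - by move=> xK; rewrite memJ_norm // (subsetP (ker_norm phim)) ?inE.
  - by rewrite K1.
  case/eqP: nH; apply/setP => x; rewrite inE; symmetry.
  have: x \in ('ker phim)%g by rewrite KT inE.
  rewrite !inE /= => /eqP/permP/(_ (enum_rank_in HC (H : {set gT})))/(congr1 enum_val).
  rewrite permE fE perm1 !enum_rankK_in // => EH.
  by rewrite -EH rcoset_refl.
have : n <= #|C|.
  apply: (@min_gT _ (phim @* [set: gT])%G); rewrite isog_sym.
  exact: sub_isog.
rewrite -(leq_pmul2r (cardG_gt0 H)) => /leq_trans -> //.
by rewrite mulnC Lagrange ?subsetT // cardsT.
Qed.
End MinimalDegree.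

Section Word.
Variables (n m : nat) (G : {group {perm 'I_n}}).
Local Notation k := m.+1.
Local Notation gT := [subg G].
Local Notation aT := (gpow 'I_m gT).
Local Notation X := (gpow 'I_m.+1 gT).

Lemma sgval_mul (x y : gT) : sgval (x * y)%g = (sgval x * sgval y)%g.
Proof. by rewrite sgvalM ?inE. Qed.

Definition word_input (h : X) (v : wvar k n) : bool :=
  let: (i, a, b) := v in sgval (h i) a == b.

Definition word_gauge (u : aT) : wvar k n -> wvar k n :=
  word_act n k (fun j => sgval (gv u (unlift ord0 (inord j)))).

Lemma word_gaugeE u i a b : word_gauge u (i, a, b) =
  (i, sgval (gv u (esrc i)) a, sgval (gv u (edst i)) b).
Proof.
rewrite /word_gauge /word_act /gcoord /esrc /edst.
have Esrc : (if (0 < i < k)%N then sgval (gv u (unlift ord0 (inord i))) else 1%g) =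
    sgval (gv u (unlift ord0 i)).
  rewrite ltn_ord andbT inord_val; case: posnP => // i0.
  by rewrite (_ : i = ord0) ?unlift_none //; apply: val_inj.
have Edst : (if (0 < i.+1 < k)%N then sgval (gv u (unlift ord0 (inord i.+1))) else 1%g) =
    sgval (gv u (unlift ord0 (ordS i))).
  rewrite /=; have [lt|ge] := ltnP i.+1 k.
    by congr (sgval (gv u (unlift ord0 _))); apply: val_inj; rewrite /= inordK // modn_small.
  rewrite (_ : ordS i = ord0) ?unlift_none //; apply: val_inj.
  by rewrite /= (_ : i.+1 = k) ?modnn //; apply/eqP; rewrite eqn_leq ge ltn_ord.
by rewrite Esrc Edst.
Qed.

Lemma word_gauge1 : word_gauge 1%g =1 id.
Proof.
move=> [[i a] b]; rewrite word_gaugeE.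
have gv1 o : gv (1%g : aT) o = 1%g by case: o => [j|] //=; rewrite gpow1.
by rewrite !gv1 !perm1.
Qed.

Lemma word_gaugeM u v : word_gauge (u * v)%g =1 word_gauge v \o word_gauge u.
Proof.
move=> [[i a] b]; rewrite -[RHS]/(word_gauge v (word_gauge u (i, a, b))).
by rewrite !word_gaugeE !gvM !sgval_mul !permM.
Qed.

Lemma word_input_gact u h : word_input (gact u h) =1 word_input h \o word_gauge u.
Proof.
move=> [[i a] b]; rewrite -[RHS]/(word_input h (word_gauge u (i, a, b))).
rewrite word_gaugeE /= gactE !sgval_mul !permM.
set s := gv u (edst i).
have -> : sgval s^-1%g = (sgval s)^-1%g by [].
by rewrite (canF_eq (permKV _)).
Qed.

Lemma word_input_dom h : word_dom n k G (word_input h).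
Proof.
move=> i; exists (sgval (h i)); first exact: subgP.
by apply/matrixP => a b; rewrite !mxE.
Qed.

Lemma word_word_input h (a0 : 'I_n) : a0 = 0 :> nat ->
  word n k (word_input h) = (sgval (\prod_(i < k) h i)%g a0 == a0).
Proof.
move=> a00.
have -> : word n k (word_input h) = ((\prod_(i < k) wmx (word_input h) i)%R a0 a0 == 1%R).
  apply/existsP/idP => [[a /andP[/eqP a_0 H]]|H]; last by
    exists a0; rewrite H andbT; apply/eqP.
  by rewrite (_ : a0 = a) //; apply: val_inj; rewrite [RHS]a_0.
have -> : (\prod_(i < k) wmx (word_input h) i)%R =
          perm_mx (sgval (\prod_(i < k) h i)%g) :> 'M[int]_n.
  rewrite (@big_morph _ _ (fun x : gT => perm_mx (sgval x) : 'M[int]_n) 1%R *%R%R).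
  - by apply: eq_bigr => i _; apply/matrixP => a b; rewrite !mxE.
  - by move=> x y; rewrite sgval_mul perm_mxM.
  - by rewrite perm_mx1.
by rewrite !mxE; case: (sgval (\prod_(i < k) h i)%g a0 == a0).
Qed.

Hypothesis simple_G : simple G.
Hypothesis min_G : forall (m : nat) (H : {group {perm 'I_m}}), H \isog G -> n <= m.

Lemma simple_subg : simple [set: gT].
Proof. by rewrite -(isog_simple (isog_subg G)). Qed.

Lemma index_subg_ge (H : {group gT}) : H :!=: [set: gT] -> n * #|H| <= #|gT|.
Proof.
apply: index_ge_min_degree; first exact: simple_subg.
move=> l K KG; apply: min_G; apply: isog_trans KG _.
by rewrite isog_sym isog_subg.
Qed.

Lemma moved_point : exists (g : gT) (p : 'I_n), sgval g p != p.
Proof.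
have [g gn1] : exists g : gT, g != 1%g.
  have /trivgPn [g _ gn1] : [set: gT] != 1%g by have [] := simpleP _ simple_subg.
  by exists g.
exists g; apply/existsP; rewrite -negb_forall; apply: contra gn1 => /forallP fixg.
apply/eqP; apply: val_inj; apply/permP => p; rewrite perm1.
by have /eqP := fixg p.
Qed.

Lemma degree_gt0 : 0 < n.
Proof. by have [g [p _]] := moved_point; apply: leq_trans (ltn_ord p). Qed.

(** If [a0] were fixed by all of [G], a moved point [p] would have an orbit avoiding [a0], so its
    stabiliser would be proper of index below [n]. *)
Lemma moved_zero (a0 : 'I_n) : exists g : gT, sgval g a0 != a0.
Proof.
apply/existsP; rewrite -[X in is_true X]negbK negb_exists; apply/negP => /forallP fix0.
have [g [p gp]] := moved_point.
pose Hp := [set x : gT | sgval x p == p].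
have Hgrp : group_set Hp.
  apply/group_setP; split=> [|x y]; first by rewrite inE perm1.
  by rewrite !inE sgval_mul permM => /eqP -> .
have := @index_subg_ge (group Hgrp); rewrite /= => /(_ _).
have nHp : Hp != [set: gT].
  by apply: contra gp => /eqP/setP/(_ g); rewrite !inE.
move=> /(_ nHp).
have pa0 : p != a0.
  by apply: contra gp => /eqP ->; have := fix0 g; rewrite negbK.
have fib q : #|[set x : gT | sgval x p == q]| <= #|Hp|.
  have [->|[x0]] := set_0Vmem [set x : gT | sgval x p == q]; first by rewrite cards0.
  rewrite inE => /eqP x0p; rewrite -(card_rcoset Hp x0); apply: subset_leq_card.
  apply/subsetP => x; rewrite inE => /eqP xp; rewrite mem_rcoset inE sgval_mul permM xp.
  by rewrite -x0p; apply/eqP; apply: permK.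
have fib0 : #|[set x : gT | sgval x p == a0]| = 0.
  apply/eqP; rewrite cards_eq0 -subset0; apply/subsetP => x; rewrite inE => /eqP xp.
  have := fix0 x; rewrite negbK => /eqP x0; case/eqP: pa0.
  by apply: (@perm_inj _ (sgval x)); rewrite xp x0.
have -> : #|gT| = \sum_(q : 'I_n) #|[set x : gT | sgval x p == q]|.
  rewrite -sum1_card (partition_big (fun x : gT => sgval x p) predT) //=.
  by apply: eq_bigr => q _; rewrite sum1dep_card.
rewrite (bigD1 a0) //= fib0 add0n leqNgt => /negP; apply.
apply: (@leq_ltn_trans (\sum_(q < n | q != a0) #|Hp|)); first exact: leq_sum.
rewrite sum_nat_const ltn_pmul2r; last by rewrite -[Hp]/(gval (group Hgrp)) cardG_gt0.
by rewrite (@eq_card _ _ (predC1 a0)) // cardC1 card_ord ltn_predL degree_gt0.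
Qed.

Lemma word_lower_bound (Phi : tc (wvar k n)) :
  word_invariant n k G Phi -> tc_computes Phi (word_dom n k G) (word n k) ->
  exists ts : seq nat, [/\ size ts <= tc_depth Phi,
    k <= \prod_(t <- ts) t.+1 & n ^ sumn ts <= tc_size Phi].
Proof.
move=> inv comp; pose a0 := Ordinal degree_gt0; have [g ga0] := moved_zero a0.
(* The identity word has product [1], while a single letter [g] gives product [g], which moves the
   first point. The position [e] stays free because the two cases choose it differently. *)
have sep e : ev word_input Phi 1%g <> ev word_input Phi (sgl e g).
  rewrite /ev !comp; try exact: word_input_dom.
  rewrite !(@word_word_input _ a0) //.
  rewrite big1 => [|i _]; last by rewrite gpow1.
  rewrite (eq_bigr (fun i => if i == e then g else 1%g)) => [|i _]; last by rewrite sglE.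
  by rewrite -big_mkcond big_pred1_eq (negPf ga0) /= perm1 eqxx.
have stab (U : {set aT}) : U \subset tc_stab word_gauge Phi.
  apply/subsetP => u _; apply/tc_stabP; apply: inv => j; exact: subgP.
have lit_dep (l : lit (wvar k n)) : (exists b, l = LConst b) \/
    exists i, forall z z' : X, z i = z' i ->
      eval_lit (word_input z) l = eval_lit (word_input z') l.
  case: l => [b|[[i a] b]|[[i a] b]]; [by left; exists b|right..];
    by exists i => z z' /= ->.
have [ab|nab] := boolP (abelian [set: gT]).
  have pr : prime #|gT|.
    by rewrite -cardsT; apply: simple_sol_prime simple_subg; apply: abelian_sol.
  have le_n : n <= #|gT|.
    have := @index_subg_ge 1%G; rewrite cards1 muln1; apply.
    by rewrite eq_sym; have [] := simpleP _ simple_subg.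
  have cm (x y : gT) : commute x y by apply: (centsP ab); rewrite inE.
  have := @formula_descent _ _ _ word_gauge word_input (@gact m gT) word_gauge1 word_gaugeM
    word_input_gact n k _ id (@ab_rel m gT) (ab_step pr erefl le_n cm) _ Phi [set: aT]%G 1 1%g
    (sgl ord0 g) (stab _) (ab_root g) (sep ord0).
  case=> [s q x y l lt R inv'|ts [d kts nts]].
    have [[b ->]//|[i dep]] := lit_dep l.
    exact: (ab_leaf (f := fun z => eval_lit (word_input z) l) lt R inv' dep).
  by exists ts; rewrite mul1n in kts.
have [m0|m_gt0] := posnP m.
  exists [::]; split=> //=; first by rewrite big_nil m0.
  by rewrite expn0; apply: tc_size_gt0 (sep ord0).
(* With [e] outside the negligible set, the two words agree on it and so start out
   indistinguishable. *)
have [e eN] := @negl_croot m gT m_gt0.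
have := @formula_descent _ _ _ word_gauge word_input (@gact m gT) word_gauge1 word_gaugeM
    word_input_gact n k _ (@cgrp m gT) (@crel m gT)
    (nab_step simple_subg nab degree_gt0 index_subg_ge) _ Phi (croot m gT) 1 1%g
    (sgl e g) (stab _) _ (sep e).
case=> [s q x y l lt R inv'| i iN|ts [d kts nts]].
- have [[b ->]//|[i dep]] := lit_dep l.
  exact: (nab_leaf (f := fun z => eval_lit (word_input z) l) R inv' dep).
- rewrite gpow1 sglE; case: eqP => // ie; by rewrite -ie iN in eN.
by exists ts; rewrite mul1n in kts.
Qed.

End Word.

(** * Numerical bounds *)

Section RealBounds.
Local Open Scope R_scope.

Lemma INR_expn (a b : nat) : INR (a ^ b)%N = INR a ^ b.
Proof. by elim: b => //= b IH; rewrite expnS mult_INR IH. Qed.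

Lemma INR_prod (ts : seq nat) : 0 < INR (\prod_(t <- ts) t.+1)%N.
Proof. by apply: lt_0_INR; apply/ltP; apply: prodn_gt0. Qed.

Lemma ln_mono x y : 0 < x -> x <= y -> ln x <= ln y.
Proof.
move=> x0 [xy|<-]; last by right.
by left; apply: ln_increasing.
Qed.

Lemma ln_le_sub1 x : 0 < x -> ln x <= x - 1.
Proof. by move=> x0; have := exp_ineq1_le (ln x); rewrite exp_ln //; lra. Qed.

(** Each factor satisfies [t + 1 <= 2 ^ t]. *)
Lemma ln_prod_le_log2 (ts : seq nat) :
  ln (INR (\prod_(t <- ts) t.+1)%N) <= INR (sumn ts) * ln 2.
Proof.
have -> : INR (sumn ts) * ln 2 = ln (INR (2 ^ sumn ts)%N).
  rewrite INR_expn -Rpower_pow; last exact: lt_0_INR (Nat.lt_0_succ _).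
  by rewrite ln_Rpower.
apply: ln_mono (INR_prod ts) _; apply: le_INR; apply/leP.
elim: ts => [|t ts IH]; first by rewrite big_nil.
by rewrite big_cons /= expnD leq_mul // ltn_expl.
Qed.

(* The tangent line of [ln] at [c], summed over the [d] factors. *)
Lemma ln_prod_tangent c (ts : seq nat) (d : nat) : 0 < c -> (size ts <= d)%N ->
  ln (INR (\prod_(t <- ts) t.+1)%N) <=
    INR d * (ln c - 1) + (INR d + INR (sumn ts)) / c.
Proof.
move=> c0.
have tang x : 0 < x -> ln x <= ln c - 1 + x / c.
  move=> x0; have xc : 0 < x / c by apply: Rdiv_lt_0_compat.
  have := ln_le_sub1 xc; rewrite /Rdiv ln_mult ?ln_Rinv //; last exact: Rinv_0_lt_compat.
  by lra.
elim: d ts => [|d IH] [|t ts] //=.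
- by move=> _; rewrite big_nil ln_1 /=; lra.
(* A list shorter than [d] is padded with factors [1]. *)
- move=> _; have := IH [::] isT; rewrite big_nil ln_1 -/(INR d.+1) S_INR /=.
  by have := tang 1 Rlt_0_1; rewrite ln_1 /Rdiv; lra.
rewrite ltnS => le_d; rewrite big_cons mult_INR ln_mult; last exact: INR_prod.
  have := tang (INR t.+1) (lt_0_INR _ (Nat.lt_0_succ _)); have := IH ts le_d.
  rewrite -/(INR d.+1) plus_INR -/(INR t.+1) !S_INR /Rdiv; lra.
exact: lt_0_INR (Nat.lt_0_succ _).
Qed.

End RealBounds.

Unset Implicit Arguments.

Theorem theorem1p3 (n : nat) (G : {group {perm 'I_n}}) :
  simple G ->
  (forall (m : nat) (H : {group {perm 'I_m}}), H \isog G -> (n <= m)%N) ->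
  forall k d : nat, (0 < k)%N -> (0 < d)%N ->
  (forall Phi : tc (wvar k n),
      word_invariant n k G Phi -> tc_computes Phi (word_dom n k G) (word n k) ->
      Rle (bound_TC n k) (INR (tc_size Phi)))
  /\
  (forall Phi : tc (wvar k n),
      word_invariant n k G Phi -> (tc_depth Phi <= d)%N ->
      tc_computes Phi (word_dom n k G) (word n k) ->
      Rle (bound_TCd n k d) (INR (tc_size Phi))).
Proof.
move=> simpleG minG [//|k] d _ d_gt0.
have n1 : Rle 1 (INR n).
  by apply: (le_INR 1); apply/leP; apply: (degree_gt0 simpleG).
have n0 : Rlt 0 (INR n) by lra.
have k0 : Rlt 0 (INR k.+1) by apply: lt_0_INR (Nat.lt_0_succ _).
have d0 : Rlt 0 (INR d) by apply: lt_0_INR; apply/ltP.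
have conclude (ts : seq nat) e s : (n ^ sumn ts <= s)%N -> Rle e (INR (sumn ts)) ->
    Rle (Rpower (INR n) e) (INR s).
  move=> /leP/le_INR les le_e; apply: Rle_trans les; rewrite INR_expn -Rpower_pow //.
  exact: Rle_Rpower.
split=> Phi inv; [move=> comp|move=> dep comp].
  have [ts [_ /leP/le_INR kts nts]] := word_lower_bound simpleG minG inv comp.
  apply: conclude nts _; have := ln_prod_le_log2 ts; have := ln_mono k0 kts.
  have ln2 : Rlt 0 (ln 2) by rewrite -ln_1; apply: ln_increasing; lra.
  move=> h1 h2; apply: (Rmult_le_reg_r (ln 2)) => //.
  by rewrite /Rdiv Rmult_assoc Rinv_l; lra.
have [ts [lets /leP/le_INR kts nts]] := word_lower_bound simpleG minG inv comp.
(* [c] is the [d]-th root of [k], the common value of [d] equal factors with product [k]. The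
   tangent there turns [d ln c <= ln prod] into [d c <= d + sumn ts]. *)
apply: conclude nts _; set c := Rpower (INR k.+1) _.
have c0 : Rlt 0 c by apply: exp_pos.
have := ln_prod_tangent c0 (leq_trans lets dep); have := ln_mono k0 kts.
have -> : ln (INR k.+1) = Rmult (INR d) (ln c).
  by rewrite /c ln_Rpower; field; lra.
move=> h1 h2.
have h3 : Rle (INR d) (Rdiv (Rplus (INR d) (INR (sumn ts))) c) by lra.
have := Rmult_le_compat_r c _ _ (Rlt_le _ _ c0) h3.
rewrite /Rdiv Rmult_assoc Rinv_l; lra.
Qed.
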